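(* Let $\mathcal{S}$ be a set of polynomial identities. If there is a noncommutative ring for which the elements of $\mathcal{S}$ are identities, then there exists a finite noncommutative ring for which the elements of $\mathcal{S}$ are identities.
   Context: All rings are associative with an identity element $1$. A noncommutative ring is a ring that is not commutative. A polynomial identity here is a polynomial $P\in\mathbb{Z}\{X_1,\ldots,X_s\}$ for some $s$ (an element of the free associative unital ring on noncommuting variables), and $P$ is an identity for a ring $R$ if $P(r_1,\ldots,r_s)=0$ for all $r_1,\ldots,r_s\in R$. The set $\mathcal{S}$ may be infinite. *)

(* Defs.v *)
From HB Require Import structures.
From mathcomp Require Import all_boot all_order all_algebra.
From mathcomp.multinomials Require Import monalg.

Set Implicit Arguments.
Unset Strict Implicit.
Unset Printing Implicit Defensive.

Import GRing.Theory.
Local Open Scope ring_scope.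

(* Z{X_1, ..., X_s}: the monoid ring over int of the free monoid on 'I_s. *)
Notation ncpoly s := {malg int[{fmonom 'I_s}]}.

(* A word m coerces to the sequence of the indices of its letters, and the
   product follows their order. *)
Definition word_eval (s : nat) (R : nzRingType) (r : 'I_s -> R)
    (m : {fmonom 'I_s}) : R :=
  \prod_(i <- m) r i.

Definition nceval (s : nat) (R : nzRingType) (r : 'I_s -> R) (P : ncpoly s) : R :=
  mmap (intmul 1) (word_eval r) P.

Definition is_identity (s : nat) (P : ncpoly s) (R : nzRingType) : Prop :=
  forall r : 'I_s -> R, nceval r P = 0.

(* A set of polynomial identities, in which the number s of variables may
   depend on the polynomial. *)
Definition identity_set : Type := forall s : nat, ncpoly s -> Prop.

Definition satisfies (S : identity_set) (R : nzRingType) : Prop :=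
  forall (s : nat) (P : ncpoly s), S s P -> is_identity P R.

Definition noncommutative (R : nzRingType) : Prop :=
  ~ commutative (@GRing.mul R).

Section NcevalMorphism.
Variables (s : nat) (R : nzRingType) (r : 'I_s -> R).

Fact word_eval_mmorphism : mmorphism (word_eval r).
Proof.
by split=> [m1 m2|]; rewrite /word_eval ?fmM ?big_cat // fm1 big_nil.
Qed.

HB.instance Definition _ :=
  isMultiplicative.Build _ _ (word_eval r) word_eval_mmorphism.

Fact nceval_is_zmod_morphism : zmod_morphism (nceval r).
Proof. by move=> P Q; rewrite /nceval raddfB. Qed.

Fact nceval_is_monoid_morphism : monoid_morphism (nceval r).
Proof.
have comm_coef (P : ncpoly s) (m m' : {fmonom 'I_s}) :
    GRing.comm ((P@_m)%:~R) (word_eval r m').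
  exact/commr_sym/commr_int.
have [evalM eval1] := commr_mmap_is_multiplicative comm_coef.
by split.
Qed.

HB.instance Definition _ := GRing.isZmodMorphism.Build _ _ (nceval r)
  nceval_is_zmod_morphism.
HB.instance Definition _ := GRing.isMonoidMorphism.Build _ _ (nceval r)
  nceval_is_monoid_morphism.

Lemma nceval_var (i : 'I_s) : nceval r << fmu i >> = r i.
Proof. by rewrite /nceval mmapU mul1r /word_eval fmU big_seq1. Qed.

End NcevalMorphism.

(* Main.v *)
(** Suppose that every finite ring of the variety [V] defined by [S] is
    commutative, and let [R] be a noncommutative ring of [V].  We may take [R]
    generated by two elements [x], [y] and, by Zorn's lemma, such that
    [c = xy - yx] lies in every nonzero ideal; let [H] be the ideal of [c].

    If [H^2 = 0], then [H] is a simple cyclic module over the commutative ring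
    [Z[X1, Y1, X2, Y2]] acting by left and right multiplications, so it is
    finite by the Nullstellensatz over [Z].  Hence [x] and [y] satisfy monic
    integer polynomials [g] with [g(x)] killing [H] on both sides; [g(x)^2] is
    then central and kills [H], so it is nilpotent by Hilbert's basis theorem,
    and [R] is finite, a contradiction.  So in [V] commutators lying in an
    ideal of square zero vanish.

    If [H^2 <> 0], then [R] is prime, and the previous remark makes it reduced,
    hence a domain.  Its center is finite: otherwise [R[t]/(t^2)] would be in
    [V], where the ideal of [t] has square zero.  So [R] has prime
    characteristic [p].  As the ring of 2 x 2 matrices over [F_p] is not in
    [V], some identity is nonzero modulo [p], and [R] satisfies a multilinear
    identity.  A shortest linear generalized identity argument in the style of
    Martindale shows that [R] is a division ring, and Kaplansky's density
    argument that every element is algebraic over the finite center, hence of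
    finite multiplicative order.  For a noncentral [x] of order [n], a discrete
    Fourier transform of conjugation by [x] gives [y <> 0] with
    [y x = x^(i+1) y] and [x^(i+1) <> x]; then [x], [y] generate a finite
    noncommutative ring. *)

Require Import Defs.
From HB Require Import structures.
From mathcomp Require Import all_boot all_order all_algebra.
From mathcomp.multinomials Require Import monalg.
From mathcomp Require Import boolp classical_sets.
From mathcomp Require Import zify.

Set Implicit Arguments.
Unset Strict Implicit.
Unset Printing Implicit Defensive.

Import Order.TTheory GRing.Theory Num.Theory.
Import Pdiv.Ring Pdiv.RingMonic.
Local Open Scope ring_scope.

(** * Ideals and subquotients *)

Record subring (R : nzRingType) (A : R -> Prop) : Prop := Subring {
  subring1 : A 1;
  subringB : forall a b, A a -> A b -> A (a - b);
  subringM : forall a b, A a -> A b -> A (a * b) }.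

Record ideal_of (R : nzRingType) (A I : R -> Prop) : Prop := IdealOf {
  ideal_ofS : forall a, I a -> A a;
  ideal_of0 : I 0;
  ideal_ofB : forall a b, I a -> I b -> I (a - b);
  ideal_ofMl : forall r a, A r -> I a -> I (r * a);
  ideal_ofMr : forall r a, A r -> I a -> I (a * r) }.

Record ideal (R : nzRingType) (I : R -> Prop) : Prop := Ideal {
  ideal0 : I 0;
  idealB : forall a b, I a -> I b -> I (a - b);
  idealMl : forall r a, I a -> I (r * a);
  idealMr : forall r a, I a -> I (a * r) }.

Section SubringTheory.
Variables (R : nzRingType) (A : R -> Prop).
Hypothesis sA : subring A.

Lemma subring0 : A 0.
Proof. by rewrite -(subrr 1); apply: subringB sA _ _ (subring1 sA) (subring1 sA). Qed.

Lemma subringN a : A a -> A (- a).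
Proof. by rewrite -sub0r; apply: (subringB sA) subring0. Qed.

Lemma subringD a b : A a -> A b -> A (a + b).
Proof. by move=> Aa Ab; rewrite -[b]opprK; apply: (subringB sA) Aa (subringN Ab). Qed.

Lemma subring_sum J (s : seq J) (P : pred J) (F : J -> R) :
  (forall j, P j -> A (F j)) -> A (\sum_(j <- s | P j) F j).
Proof. by move=> AF; apply: big_ind => //; [exact: subring0|exact: subringD]. Qed.

Lemma subring_prod J (s : seq J) (P : pred J) (F : J -> R) :
  (forall j, P j -> A (F j)) -> A (\prod_(j <- s | P j) F j).
Proof. by move=> AF; apply: big_ind => //; [exact: subring1|exact: subringM]. Qed.

Lemma subring_nat n : A n%:R.
Proof.
by elim: n => [|n IHn]; rewrite ?mulrS; [exact: subring0|exact: subringD (subring1 sA) _].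
Qed.

Lemma subring_int z : A z%:~R.
Proof.
by case: z => n; rewrite ?NegzE ?mulrNz; [|apply: subringN]; exact: subring_nat.
Qed.

End SubringTheory.

Section IdealTheory.
Variables (R : nzRingType) (I : R -> Prop).
Hypothesis iI : ideal I.

Lemma idealN a : I a -> I (- a).
Proof. by rewrite -sub0r; apply: (idealB iI) (ideal0 iI). Qed.

Lemma idealD a b : I a -> I b -> I (a + b).
Proof. by move=> Ia Ib; rewrite -[b]opprK; apply: (idealB iI) Ia (idealN Ib). Qed.

End IdealTheory.

Lemma subringT (R : nzRingType) : subring (fun _ : R => True).
Proof. by []. Qed.

Lemma ideal_ofT (R : nzRingType) (I : R -> Prop) :
  ideal I -> ideal_of (fun _ => True) I.
Proof. by case=> *; split; auto. Qed.

(** [pi] is total on [R] but constrained only on [A], where it is a surjective homomorphism with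
    kernel [I]. Subrings are the case of zero [I], quotients the case of full [A]. *)
Record subquotient_map (R : nzRingType) (A I : R -> Prop) (Q : nzRingType)
    (pi : R -> Q) : Prop := SubquotientMap {
  sq1 : pi 1 = 1;
  sqB : forall a b, A a -> A b -> pi (a - b) = pi a - pi b;
  sqM : forall a b, A a -> A b -> pi (a * b) = pi a * pi b;
  sq_onto : forall q, exists2 a, A a & pi a = q;
  sq_eq0 : forall a, A a -> (pi a = 0 <-> I a) }.

Section SubquotientMapTheory.
Variables (R : nzRingType) (A I : R -> Prop) (Q : nzRingType) (pi : R -> Q).
Hypotheses (sA : subring A) (qpi : subquotient_map A I pi).

Lemma sq0 : pi 0 = 0.
Proof. by rewrite -(subrr 1) (sqB qpi) ?subrr //; exact: subring1. Qed.

Lemma sqN a : A a -> pi (- a) = - pi a.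
Proof. by move=> Aa; rewrite -sub0r (sqB qpi) ?sq0 ?sub0r //; exact: subring0. Qed.

Lemma sqD a b : A a -> A b -> pi (a + b) = pi a + pi b.
Proof.
by move=> Aa Ab; rewrite -{1}[b]opprK (sqB qpi) ?sqN ?opprK //; exact: subringN.
Qed.

Lemma sq_sum J (s : seq J) (F : J -> R) :
  (forall j, A (F j)) -> pi (\sum_(j <- s) F j) = \sum_(j <- s) pi (F j).
Proof.
move=> AF; elim: s => [|j s IHs]; rewrite ?big_nil ?big_cons ?sq0 // sqD ?IHs //.
exact: subring_sum.
Qed.

Lemma sq_prod J (s : seq J) (F : J -> R) :
  (forall j, A (F j)) -> pi (\prod_(j <- s) F j) = \prod_(j <- s) pi (F j).
Proof.
move=> AF; elim: s => [|j s IHs]; rewrite ?big_nil ?big_cons ?(sq1 qpi) //.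
by rewrite (sqM qpi) ?IHs //; exact: subring_prod.
Qed.

Lemma sq_nat n : pi n%:R = n%:R.
Proof.
elim: n => [|n IHn]; first exact: sq0.
by rewrite !mulrS sqD ?IHn ?(sq1 qpi) //; [exact: subring1|exact: subring_nat].
Qed.

Lemma sq_int z : pi z%:~R = z%:~R.
Proof.
case: z => n; rewrite ?NegzE ?mulrNz -?pmulrn ?sqN ?sq_nat //.
exact: subring_nat.
Qed.

Lemma satisfies_subquotient S : satisfies S R -> satisfies S Q.
Proof.
move=> satR s P SP r.
have [r' Ar'] : {r' : 'I_s -> R & forall i, A (r' i) /\ pi (r' i) = r i}.
  by apply: (@choice _ _ (fun i x => A x /\ pi x = r i)) => i;
     have [a] := sq_onto qpi (r i); exists a.
have AW (m : {fmonom 'I_s}) : A (word_eval r' m).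
  by apply: subring_prod => // i _; case: (Ar' i).
suff: nceval r P = pi (nceval r' P) by rewrite (satR _ _ SP) sq0.
rewrite /nceval !mmapE sq_sum => [|m]; last first.
  by apply: subringM => //; exact: subring_int.
apply: eq_bigr => m _; rewrite (sqM qpi) ?sq_int //; last exact: subring_int.
rewrite /word_eval sq_prod => [|i]; last by case: (Ar' i).
by congr (_ * _); apply: eq_bigr => i _; case: (Ar' i).
Qed.

End SubquotientMapTheory.

Section Subquotient.
Variables (R : nzRingType) (A I : R -> Prop).
Hypotheses (sA : subring A) (iI : ideal_of A I) (I1 : ~ I 1).

Let coset (x : R) : set R := [set y | A y /\ I (y - x)]%classic.
Let canon (x : R) : R := xget 0 (coset x).

Let IN a : I a -> I (- a).
Proof. by rewrite -sub0r; apply: (ideal_ofB iI) (ideal_of0 iI). Qed.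

Let ID a b : I a -> I b -> I (a + b).
Proof. by move=> Ia Ib; rewrite -[b]opprK; apply: (ideal_ofB iI) Ia (IN Ib). Qed.

Let canonP x : A x -> A (canon x) /\ I (canon x - x).
Proof.
move=> Ax; have : coset x (canon x) by apply: (@xgetI _ _ _ x); split=> //;
  rewrite subrr; exact: ideal_of0 iI.
by [].
Qed.

Let canon_eq x y : I (x - y) -> canon x = canon y.
Proof.
move=> Ixy; rewrite /canon; congr (xget 0 _).
apply: funext => z; apply: propext; split=> -[Az Iz]; split=> //.
  have -> : z - y = (z - x) + (x - y) by rewrite addrA subrK.
  exact: ID.
have -> : z - x = (z - y) - (x - y) by rewrite opprB addrA subrK.
exact: ideal_ofB iI _ _ Iz Ixy.
Qed.

Let canonical (x : R) : bool := `[< A x /\ canon x = x >].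

Definition subquot := {x : R | canonical x}.

HB.instance Definition _ := Choice.on subquot.

Let canonK x : A x -> canon (canon x) = canon x.
Proof. by move=> Ax; apply: canon_eq; case: (canonP Ax). Qed.

Let subquot_pi_proof x :
  canonical (if pselect (A x) then canon x else canon 0).
Proof.
apply/asboolP; have A0 := subring0 sA.
by case: pselect => Ax; rewrite canonK //; split=> //;
   [case: (canonP Ax)|case: (canonP A0)].
Qed.

Definition subquot_pi (x : R) : subquot :=
  exist (fun x => is_true (canonical x)) _ (subquot_pi_proof x).

Let piE x : A x -> val (subquot_pi x) = canon x.
Proof. by move=> Ax /=; case: pselect. Qed.

Let valA (q : subquot) : A (val q).
Proof. by case: q => x /= /asboolP[]. Qed.

Let pi_val (q : subquot) : subquot_pi (val q) = q.
Proof. by apply: val_inj; rewrite piE //; case: q => x /= /asboolP[]. Qed.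

Let pi_eq x y : A x -> A y -> (subquot_pi x = subquot_pi y <-> I (x - y)).
Proof.
move=> Ax Ay; split=> [/(congr1 val)|Ixy]; last first.
  by apply: val_inj; rewrite !piE //; exact: canon_eq.
rewrite !piE // => exy.
have -> : x - y = (canon y - y) - (canon x - x).
  by rewrite exy opprB [RHS]addrC addrA subrK.
by apply: ideal_ofB iI _ _ _ _; [case: (canonP Ay)|case: (canonP Ax)].
Qed.

Let val_pi x : A x -> I (val (subquot_pi x) - x).
Proof. by move=> Ax; rewrite piE //; case: (canonP Ax). Qed.

Let add (p q : subquot) := subquot_pi (val p + val q).
Let opp (p : subquot) := subquot_pi (- val p).
Let mul (p q : subquot) := subquot_pi (val p * val q).

Let piD x y : A x -> A y -> subquot_pi (x + y) = add (subquot_pi x) (subquot_pi y).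
Proof.
move=> Ax Ay; apply/pi_eq; [exact: subringD|exact: subringD|].
rewrite opprD addrACA -opprB -[y - _]opprB.
by apply: ID; apply: IN; exact: val_pi.
Qed.

Let piN x : A x -> subquot_pi (- x) = opp (subquot_pi x).
Proof.
move=> Ax; apply/pi_eq; [exact: subringN|exact: subringN|].
by rewrite opprK addrC; exact: val_pi.
Qed.

Let piM x y : A x -> A y -> subquot_pi (x * y) = mul (subquot_pi x) (subquot_pi y).
Proof.
move=> Ax Ay; apply/pi_eq; [exact: subringM|exact: subringM|].
set x' := val _; set y' := val _.
have -> : x * y - x' * y' = - ((x' - x) * y' + x * (y' - y)).
  by rewrite mulrBl mulrBr addrA subrK opprB.
apply: IN; apply: ID; [apply: (ideal_ofMr iI)|apply: (ideal_ofMl iI)] => //;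
  (exact: val_pi || exact: valA).
Qed.

Let pi_ind (P : subquot -> Prop) : (forall x, A x -> P (subquot_pi x)) -> forall q, P q.
Proof. by move=> H q; rewrite -(pi_val q); apply: H. Qed.

Let addA : associative add.
Proof.
elim/pi_ind=> x Ax; elim/pi_ind=> y Ay; elim/pi_ind=> z Az.
by rewrite -!piD ?addrA //; exact: subringD.
Qed.

Let addC : commutative add.
Proof.
by elim/pi_ind=> x Ax; elim/pi_ind=> y Ay; rewrite -!piD // addrC.
Qed.

Let add0 : left_id (subquot_pi 0) add.
Proof.
by elim/pi_ind=> x Ax; rewrite -piD ?add0r //; exact: subring0.
Qed.

Let addN : left_inverse (subquot_pi 0) opp add.
Proof.
by elim/pi_ind=> x Ax; rewrite -piN // -piD ?addNr //; exact: subringN.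
Qed.

HB.instance Definition _ := GRing.isZmodule.Build subquot addA addC add0 addN.

Let mulA : associative mul.
Proof.
elim/pi_ind=> x Ax; elim/pi_ind=> y Ay; elim/pi_ind=> z Az.
by rewrite -!piM ?mulrA //; exact: subringM.
Qed.

Let mul1 : left_id (subquot_pi 1) mul.
Proof. by elim/pi_ind=> x Ax; rewrite -piM ?mul1r //; exact: subring1. Qed.

Let mulr1' : right_id (subquot_pi 1) mul.
Proof. by elim/pi_ind=> x Ax; rewrite -piM ?mulr1 //; exact: subring1. Qed.

Let mulDl : left_distributive mul add.
Proof.
elim/pi_ind=> x Ax; elim/pi_ind=> y Ay; elim/pi_ind=> z Az.
by rewrite -!(piD, piM) ?mulrDl //; (exact: subringM || exact: subringD).
Qed.

Let mulDr : right_distributive mul add.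
Proof.
elim/pi_ind=> x Ax; elim/pi_ind=> y Ay; elim/pi_ind=> z Az.
by rewrite -!(piD, piM) ?mulrDr //; (exact: subringM || exact: subringD).
Qed.

Let one_neq0 : subquot_pi 1 != 0.
Proof.
apply/eqP => /(pi_eq (subring1 sA) (subring0 sA)).
by rewrite subr0.
Qed.

HB.instance Definition _ := GRing.Zmodule_isNzRing.Build subquot
  mulA mul1 mulr1' mulDl mulDr one_neq0.

Lemma subquot_piP : subquotient_map A I subquot_pi.
Proof.
split=> //.
- by move=> a b Aa Ab; rewrite piD ?piN //; exact: subringN.
- by move=> q; exists (val q); [exact: valA|exact: pi_val].
- move=> a Aa; rewrite -[a in I a]subr0; apply: pi_eq => //; exact: subring0.
Qed.

End Subquotient.

Lemma subquotient_exists (R : nzRingType) (A I : R -> Prop) :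
    subring A -> ideal_of A I -> ~ I 1 ->
  exists (Q : nzRingType) (pi : R -> Q), subquotient_map A I pi.
Proof.
by move=> sA iI I1; exact: ex_intro _ _ (ex_intro _ _ (subquot_piP sA iI I1)).
Qed.

(** * Hearts and finiteness *)

Lemma maximal_ideal_avoiding (R : nzRingType) (c : R) : c <> 0 ->
  exists I, [/\ ideal I, ~ I c & forall J, ideal J -> (forall a, I a -> J a) ->
     forall a, J a -> ~ I a -> J c].
Proof.
(* Zorn's lemma also tests the empty chain, whose union is empty; adjoining 0 to every set keeps
   that union an ideal. *)
move=> c0; pose X0 (X : set R) a := X a \/ a = 0.
pose P (X : set R) := ideal (X0 X) /\ ~ X c.
have [F FP totF|X [[iX Xc] maxX]] := @Zorn_bigcup R P.
  split; last by move=> [X FX Xc]; case: (FP _ FX).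
  have dir a b : X0 (\bigcup_(X in F) X)%classic a ->
      X0 (\bigcup_(X in F) X)%classic b ->
      (exists X, [/\ F X, X0 X a & X0 X b]) \/ (a = 0 /\ b = 0).
    move=> [[X FX Xa]|->] [[Y FY Yb]|->]; last by right.
    - left; have [XY|YX] := totF X Y FX FY.
        by exists Y; split=> //; left=> //; apply: XY.
      by exists X; split=> //; left=> //; apply: YX.
    - by left; exists X; split=> //; [left|right].
    - by left; exists Y; split=> //; [right|left].
  have up X a : F X -> X0 X a -> X0 (\bigcup_(X in F) X)%classic a.
    by move=> FX [Xa|->]; [left; exists X|right].
  split; first by right.
  - move=> a b Ua Ub; have [[X [FX Xa Xb]]|[-> ->]] := dir a b Ua Ub.
      by apply: (up X) => //; apply: idealB => //; case: (FP _ FX).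
    by rewrite subrr; right.
  - move=> r a Ua; have [[X [FX Xa _]]|[-> _]] := dir a a Ua Ua.
      by apply: (up X) => //; apply: idealMl => //; case: (FP _ FX).
    by rewrite mulr0; right.
  - move=> r a Ua; have [[X [FX Xa _]]|[-> _]] := dir a a Ua Ua.
      by apply: (up X) => //; apply: idealMr => //; case: (FP _ FX).
    by rewrite mul0r; right.
exists (X0 X); split=> //; first by case.
move=> J iJ XJ a Ja nXa; apply: contrapT => nJc; apply: (maxX J).
- split=> [b Xb|]; first by apply: XJ; left.
  by move=> /(_ a Ja) Xa; apply: nXa; left.
- split=> //; split; first by right.
  + by move=> u v [Ju|->] [Jv|->]; left; apply: idealB => //; exact: ideal0.
  + by move=> r u [Ju|->]; left; apply: idealMl => //; exact: ideal0.
  + by move=> r u [Ju|->]; left; apply: idealMr => //; exact: ideal0.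
Qed.

Definition generated_by (R : nzRingType) (x y : R) : Prop :=
  forall A, subring A -> A x -> A y -> forall r, A r.

(** For fixed [z], the elements commuting with [z] modulo [I] form a subring. Taking [z] to be [x],
    then [y], then arbitrary spreads commutativity from the generators to the whole quotient. *)
Lemma commutators_in_ideal (R : nzRingType) (x y : R) (I : R -> Prop) :
    generated_by x y -> ideal I -> I (x * y - y * x) ->
  forall a b, I (a * b - b * a).
Proof.
move=> gen iI Ic.
have sub z : subring (fun r => I (r * z - z * r)).
  split=> [|a b Ia Ib|a b Ia Ib].
  - by rewrite mulr1 mul1r subrr; exact: ideal0.
  - have -> : (a - b) * z - z * (a - b) = (a * z - z * a) - (b * z - z * b).
      by rewrite mulrBl mulrBr !opprB addrACA [RHS]addrACA [X in _ = _ + X]addrC.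
    exact: idealB.
  - have -> : a * b * z - z * (a * b) = a * (b * z - z * b) + (a * z - z * a) * b.
      by rewrite mulrBr mulrBl !mulrA addrA subrK.
    by apply: idealD => //; [exact: idealMl|exact: idealMr].
have antisym u v : I (u * v - v * u) -> I (v * u - u * v).
  by move=> /(idealN iI); rewrite opprB.
have xr r : I (r * x - x * r).
  apply: (gen _ (sub x)); [by rewrite subrr; exact: ideal0|exact: antisym].
have yr r : I (r * y - y * r).
  apply: (gen _ (sub y)); [by []|by rewrite subrr; exact: ideal0].
by move=> a b; apply: (antisym b a); apply: (gen _ (sub a)); apply: antisym.
Qed.

(** The heart of [R]: the intersection of its nonzero two-sided ideals. *)
Definition in_heart (R : nzRingType) (h : R) : Prop :=
  forall I, ideal I -> forall a, I a -> a <> 0 -> I h.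

Lemma ideal_heart (R : nzRingType) : ideal (@in_heart R).
Proof.
split=> [|a b Ha Hb|r a Ha|r a Ha] I iI u Iu u0; first exact: ideal0.
- by apply: idealB; [|exact: Ha Iu u0|exact: Hb Iu u0].
- by apply: idealMl; [|exact: Ha Iu u0].
- by apply: idealMr; [|exact: Ha Iu u0].
Qed.

Section GeneratedSubring.
Variables (R : nzRingType) (x y : R).

Definition gen_subring (r : R) : Prop := forall A, subring A -> A x -> A y -> A r.

Lemma subring_gen : subring gen_subring.
Proof.
split=> [A sA _ _|a b Ga Gb A sA Ax Ay|a b Ga Gb A sA Ax Ay]; first exact: subring1.
- by apply: subringB; [|exact: Ga|exact: Gb].
- by apply: subringM; [|exact: Ga|exact: Gb].
Qed.

Lemma gen_subring_l : gen_subring x. Proof. by move=> A. Qed.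
Lemma gen_subring_r : gen_subring y. Proof. by move=> A. Qed.

End GeneratedSubring.

Lemma generated_subquotient (R : nzRingType) (x y : R) (I : R -> Prop)
    (Q : nzRingType) (pi : R -> Q) :
  subquotient_map (gen_subring x y) I pi -> generated_by (pi x) (pi y).
Proof.
move=> qpi B sB Bx By q; have sG := subring_gen x y.
have [a Ga <-] := sq_onto qpi q.
suff [] : gen_subring x y a /\ B (pi a) by [].
apply: (Ga (fun a => gen_subring x y a /\ B (pi a))).
- split=> [|u v [Gu Bu] [Gv Bv]|u v [Gu Bu] [Gv Bv]].
  + by split; [exact: (subring1 sG)|rewrite (sq1 qpi); exact: (subring1 sB)].
  + by split; [exact: (subringB sG)|rewrite (sqB qpi) //; exact: (subringB sB)].
  + by split; [exact: (subringM sG)|rewrite (sqM qpi) //; exact: (subringM sB)].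
- by split=> //; exact: gen_subring_l.
- by split=> //; exact: gen_subring_r.
Qed.

(** The subring generated by [x] and [y] is made a ring [T], then divided by an ideal maximal among
    those avoiding the commutator. A nonzero ideal of the quotient pulls back to a strictly larger
    ideal, hence contains the commutator. *)
Lemma subdirectly_irreducible_subquotient (R : nzRingType) (x y : R) :
    x * y <> y * x ->
  exists (Q : nzRingType) (I : R -> Prop) (pi : R -> Q),
    [/\ subquotient_map (gen_subring x y) I pi,
        pi x * pi y - pi y * pi x <> 0 &
        in_heart (pi x * pi y - pi y * pi x)].
Proof.
move=> cxy; pose A := gen_subring x y; have sA : subring A := subring_gen x y.
have [T [iota qiota]] : exists (T : nzRingType) (iota : R -> T),
    subquotient_map A (fun a => a = 0) iota.
  apply: subquotient_exists => //; last by move/eqP; rewrite oner_eq0.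
  split=> //.
  - by move=> a ->; exact: subring0.
  - by move=> a b -> ->; rewrite subrr.
  - by move=> r a _ ->; rewrite mulr0.
  - by move=> r a _ ->; rewrite mul0r.
have Ax : A x := @gen_subring_l _ x y; have Ay : A y := @gen_subring_r _ x y.
pose c := iota x * iota y - iota y * iota x.
have cE : c = iota (x * y - y * x).
  by rewrite (sqB qiota) ?(sqM qiota) //; exact: (subringM sA).
have c0 : c <> 0.
  rewrite cE => /(sq_eq0 qiota (subringB sA (subringM sA Ax Ay) (subringM sA Ay Ax))).
  by move/eqP; rewrite subr_eq0 => /eqP.
have [I [iI Ic maxI]] := maximal_ideal_avoiding c0.
have [|Q [rho qrho]] := subquotient_exists (subringT T) (ideal_ofT iI).
  by move=> I1; apply: Ic; rewrite -[c]mulr1; exact: idealMl.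
have sT := subringT T.
exists Q, (fun a => A a /\ I (iota a)), (rho \o iota); split.
- split=> [|a b Aa Ab|a b Aa Ab|q|a Aa] /=.
  + by rewrite (sq1 qiota) (sq1 qrho).
  + by rewrite (sqB qiota) // (sqB qrho).
  + by rewrite (sqM qiota) // (sqM qrho).
  + have [t _ <-] := sq_onto qrho q; have [a Aa <-] := sq_onto qiota t.
    by exists a.
  + by split=> [/(sq_eq0 qrho)|[_ Ia]]; [split=> //; auto|apply/(sq_eq0 qrho)].
- by rewrite /= -!(sqM qrho) // -(sqB qrho) // => /(sq_eq0 qrho); auto.
- move=> J iJ q Jq q0 /=; rewrite -!(sqM qrho) // -(sqB qrho) //.
  have [t _ tq] := sq_onto qrho q.
  apply: (maxI (fun t => J (rho t)) _ _ t); rewrite ?tq //.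
  + split=> [|u v Ju Jv|r u Ju|r u Ju].
    * by rewrite (sq0 sT qrho); exact: ideal0.
    * by rewrite (sqB qrho) //; exact: idealB.
    * by rewrite (sqM qrho) //; exact: idealMl.
    * by rewrite (sqM qrho) //; exact: idealMr.
  + by move=> u Iu; rewrite (iffRL (sq_eq0 qrho _)) //; exact: ideal0.
  + by move=> It; apply: q0; rewrite -tq; apply/(sq_eq0 qrho).
Qed.

(** * Finite predicates and finite rings *)

Definition finite_pred (T : eqType) (A : T -> Prop) : Prop :=
  exists s : seq T, forall a, A a -> a \in s.

Lemma finite_pred_pigeonhole (T : eqType) (A : T -> Prop) (f : nat -> T) :
  finite_pred A -> (forall n, A (f n)) -> exists i j, (i < j)%N /\ f i = f j.
Proof.
move=> [s As] Af; apply: contrapT => nij.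
have inj : {in iota 0 (size s).+1 &, injective f}.
  move=> i j _ _ fij; case: (ltngtP i j) => // lt_ij; exfalso; apply: nij.
    by exists i, j.
  by exists j, i.
have : (size (map f (iota 0 (size s).+1)) <= size s)%N.
  apply: uniq_leq_size; first by rewrite map_inj_in_uniq // iota_uniq.
  by move=> _ /mapP[i _ ->]; apply: As.
by rewrite size_map size_iota ltnn.
Qed.

Lemma finite_pred_image (T U : eqType) (A : T -> Prop) (B : U -> Prop)
    (f : T -> U -> Prop) :
  finite_pred A -> (forall u, B u -> exists2 t, A t & f t u) ->
  (forall t u v, B u -> B v -> f t u -> f t v -> u = v) -> finite_pred B.
Proof.
move=> [s As] Bf funf.
suff [s' s'P] : exists s' : seq U, forall t u, t \in s -> B u -> f t u -> u \in s'.
  by exists s' => u Bu; have [t At ftu] := Bf u Bu; apply: (s'P t) => //; apply: As.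
elim: s {As} => [|t s [s' IHs]]; first by exists [::].
have [[u [Bu ftu]]|no] := pselect (exists u, B u /\ f t u).
  exists (u :: s') => t' v; rewrite !inE => /orP[/eqP->|t's] Bv ft'v.
    by rewrite (funf t u v) // eqxx.
  by rewrite (IHs t') ?orbT.
exists s' => t' v; rewrite inE => /orP[/eqP->|t's] Bv ft'v; last exact: IHs ft'v.
by exfalso; apply: no; exists v.
Qed.

Lemma finite_pred_sub (T : eqType) (A B : T -> Prop) :
  finite_pred A -> (forall a, B a -> A a) -> finite_pred B.
Proof. by move=> [s As] BA; exists s => a /BA; exact: As. Qed.

Lemma finite_pred_map2 (T U V : eqType) (A : T -> Prop) (B : U -> Prop)
    (g : T -> U -> V) :
  finite_pred A -> finite_pred B ->
  finite_pred (fun v => exists t u, [/\ A t, B u & v = g t u]).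
Proof.
move=> [s As] [s' Bs']; exists [seq g t u | t <- s, u <- s'] => v [t [u [At Bu ->]]].
by apply/allpairsP; exists (t, u); split; [exact: As|exact: Bs'|].
Qed.

(** The counting tool for modules spanned by [n] elements over finitely many scalars: [A i] will
    consist of the multiples of the [i]-th generator. *)
Lemma finite_pred_sum (V : nmodType) (n : nat) (A : nat -> V -> Prop) :
  (forall i, (i < n)%N -> finite_pred (A i)) ->
  finite_pred (fun v => exists2 t : nat -> V,
    (forall i, (i < n)%N -> A i (t i)) & v = \sum_(i < n) t i).
Proof.
elim: n => [|n IHn] finA.
  by exists [:: 0] => v [t _ ->]; rewrite big_ord0 inE.
have finn : finite_pred (A n) by exact: finA.
have /IHn fin' i : (i < n)%N -> finite_pred (A i) by move=> lt_in; apply/finA/leqW.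
apply: finite_pred_sub (finite_pred_map2 +%R fin' finn) _ => v [t At ->].
exists (\sum_(i < n) t i), (t n); rewrite big_ord_recr /=; split=> //; last exact: At.
by exists t => // i lt_in; apply/At/leqW.
Qed.

Lemma finite_intr (R : nzRingType) (m : nat) : (0 < m)%N -> m%:R = 0 :> R ->
  finite_pred (fun r : R => exists z : int, r = z%:~R).
Proof.
move=> m_gt0 m0; exists [seq i%:R | i <- iota 0 m] => _ [z ->].
have mz : (m%:Z != 0) by rewrite eqz_nat -lt0n.
apply/mapP; exists `|(z %% m)%Z|%N.
  by rewrite mem_iota /= -ltz_nat gez0_abs ?modz_ge0 // ltz_pmod.
rewrite {1}(divz_eq z m) rmorphD rmorphM /= -[m%:~R]/(m%:R) m0 mulr0 add0r.
by rewrite -[LHS]/((z %% m)%Z%:~R) -{1}(gez0_abs (modz_ge0 z mz)).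
Qed.

Section FiniteRing.
Variables (R : nzRingType) (e : seq R).
Hypothesis eP : forall a, a \in e.

Definition listed_ring : Type := R.
HB.instance Definition _ := GRing.NzRing.on listed_ring.

Let pickle_index (a : listed_ring) := index (a : R) e.
Let unpickle_nth (n : nat) : option listed_ring :=
  if (n < size e)%N then Some (nth 0 e n) else None.

Let pickle_indexK : pcancel pickle_index unpickle_nth.
Proof. by move=> a; rewrite /unpickle_nth index_mem eP nth_index ?eP. Qed.

HB.instance Definition _ := isCountable.Build listed_ring pickle_indexK.

Let undup_enum : Finite.axiom (undup e : seq listed_ring).
Proof. by apply: Finite.uniq_enumP; [exact: undup_uniq|move=> a; rewrite mem_undup eP]. Qed.

HB.instance Definition _ := isFinite.Build listed_ring undup_enum.

Lemma listed_ring_noncommutative S :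
  noncommutative R -> satisfies S R ->
  exists Q : finNzRingType, noncommutative Q /\ satisfies S Q.
Proof. by move=> ncR satR; exists (listed_ring : finNzRingType). Qed.

End FiniteRing.

Lemma finite_ring_noncommutative S (R : nzRingType) :
  finite_pred (fun _ : R => True) -> noncommutative R -> satisfies S R ->
  exists Q : finNzRingType, noncommutative Q /\ satisfies S Q.
Proof. by case=> e eP; apply: (@listed_ring_noncommutative _ e) => a; exact: eP. Qed.

(** * The Nullstellensatz over the integers *)

(* Stated for a domain whose localization at one element is a field, rather than
   for a field, so that it passes through polynomial extensions. *)
Definition goldman_finite (R : comNzRingType) : Prop :=
  forall (L : fieldType) (phi : {rmorphism R -> L}) (s : R), phi s != 0 ->
    (forall a, phi a != 0 -> exists b k, phi a * phi b = phi s ^+ k) ->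
  finite_pred (fun z => exists a, z = phi a).

(** If [phi] were injective, a prime [q] exceeding the absolute value of [s] would divide a power of
    [s], because [phi q] becomes invertible once [phi s] is inverted. So some positive integer maps
    to 0 and the image is finite. *)
Lemma goldman_finite_int : goldman_finite int.
Proof.
move=> L phi s s0 phis.
have [[n [n_gt0 n0]]|inj] := pselect (exists n, (0 < n)%N /\ phi n%:Z = 0).
  have phiE a : phi a = a%:~R by rewrite -[a in LHS]intz rmorph_int.
  apply: finite_pred_sub (finite_intr n_gt0 _) _; first by rewrite -n0 phiE.
  by move=> _ [a ->]; exists a; rewrite phiE.
have phi0 a : phi a = 0 -> a = 0.
  move=> a0; apply: contrapT => /eqP an0; apply: inj; exists `|a|%N.
  rewrite absz_gt0 an0; split=> //.
  by rewrite abszE; case: (ger0P a) => _; rewrite ?rmorphN a0 ?oppr0.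
have sn0 : s != 0 by apply: contraNneq s0 => ->; rewrite rmorph0.
have [q lt_sq prq] := prime_above `|s|%N.
have phiq : phi q%:Z != 0.
  by apply/eqP => /phi0 /eqP; rewrite eqz_nat; case: q prq {lt_sq} => //.
have [b [k]] := phis _ phiq; rewrite -rmorphM -rmorphXn => /eqP.
rewrite -subr_eq0 -rmorphB => /eqP /phi0 /eqP; rewrite subr_eq0 => /eqP qbs.
have : (q %| `|s| ^ k)%N by rewrite -abszX -qbs abszM dvdn_mulr.
rewrite Euclid_dvdX // => /andP[/dvdn_leq]; rewrite absz_gt0 sn0 => /(_ isT).
by rewrite leqNgt lt_sq.
Qed.

(** Multiplying a monic equation of degree n+1 for [v^-1] by [v^n] expresses [v^-1] as a polynomial
    in [v] over the range of [chi]. *)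
Lemma integral_inv_in_range (S : comNzRingType) (L : fieldType)
    (chi : {rmorphism S -> L}) (b : S) :
  chi b != 0 -> integralOver chi (chi b)^-1 -> exists g, (chi b)^-1 = chi g.
Proof.
move=> b0 [q mon_q /rootP]; set v := chi b; have v0 : v != 0 by [].
have clear_denom (p : {poly S}) n : (size p <= n.+1)%N ->
    exists g, chi g = v ^+ n * (map_poly chi p).[v^-1].
  move=> szp; exists (\sum_(i < n.+1) p`_i * b ^+ (n - i)).
  rewrite (@horner_coef_wide _ n.+1) ?(leq_trans (size_poly _ _)) //.
  rewrite rmorph_sum mulr_sumr; apply: eq_bigr => i _.
  rewrite rmorphM rmorphXn coef_map mulrCA; congr (_ * _).
  by rewrite exprVn expfB_cond // (negPf v0) add0n -ltnS.
case: (posnP (size q)) => [/eqP|szq_gt0].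
  by rewrite size_poly_eq0 (negPf (monic_neq0 mon_q)).
case szq: (size q) szq_gt0 => [//|[|n]] _.
  have /monicP := mon_q; rewrite (size1_polyC (eq_leq szq)) lead_coefC => ->.
  by rewrite polyC1 rmorph1 hornerC => /eqP; rewrite oner_eq0.
pose q' := q - 'X^(n.+1); have szd : (size q' <= n.+1)%N.
  apply/leq_sizeP => j le_nj; rewrite coefB coefXn.
  have [lt_jn|lt_nj|->] := ltngtP j n.+1; first by rewrite ltnNge le_nj in lt_jn.
    by rewrite nth_default ?subr0 // szq.
  by have /monicP := mon_q; rewrite /lead_coef szq /= => ->; rewrite subrr.
have [g gE] := clear_denom _ _ szd.
move: gE; rewrite /q' rmorphB /= map_polyXn hornerD hornerN hornerXn => + q0.
rewrite q0 sub0r mulrN exprSr exprVn mulrA mulfV ?expf_neq0 // mul1r => gE.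
by exists (- g); rewrite rmorphN gE opprK.
Qed.

Section GoldmanStep.
Variables (R : comNzRingType) (L : fieldType).
Variable phi0 : {rmorphism R -> L}.

(** The range of [psi c] is the subring of [L] generated by the image of [R] and the inverse of
    [phi0 c]: a localization at one element. *)
Let psi (c : R) : {rmorphism {poly R} -> L} :=
  horner_eval (phi0 c)^-1 \o map_poly phi0.

Let psiE c g : psi c g = (map_poly phi0 g).[(phi0 c)^-1]. Proof. by []. Qed.

Let psiC c r : psi c r%:P = phi0 r.
Proof. by rewrite psiE map_polyC hornerC. Qed.

Let psiX c : psi c 'X = (phi0 c)^-1.
Proof. by rewrite psiE map_polyX hornerX. Qed.

Let integral_base c r : integralOver (psi c) (phi0 r).
Proof. by rewrite -(psiC c); apply: integral_id. Qed.

Let integral_inv_base c : integralOver (psi c) (phi0 c)^-1.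
Proof. by rewrite -psiX; apply: integral_id. Qed.

Let integral_inv_l a e : phi0 e != 0 -> integralOver (psi (a * e)) (phi0 a)^-1.
Proof.
move=> e0; have -> : (phi0 a)^-1 = phi0 e * (phi0 (a * e))^-1.
  by rewrite rmorphM invfM mulrCA divff ?mulr1.
by apply: integral_mul; [exact: integral_base|exact: integral_inv_base].
Qed.

Let integral_inv_r a e : phi0 a != 0 -> integralOver (psi (a * e)) (phi0 e)^-1.
Proof.
move=> a0; have -> : (phi0 e)^-1 = phi0 a * (phi0 (a * e))^-1.
  by rewrite rmorphM invfM mulrA divff ?mul1r.
by apply: integral_mul; [exact: integral_base|exact: integral_inv_base].
Qed.

Let integral_map (S : comNzRingType) (chi : {rmorphism S -> L}) (p : {poly R}) :
  (forall r, integralOver chi (phi0 r)) ->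
  {in (map_poly phi0 p : seq L), integralRange chi}.
Proof. by move=> chiP; apply/(integral_poly chi) => i; rewrite coef_map; exact: chiP. Qed.

Let integralX (S : comNzRingType) (chi : {rmorphism S -> L}) w k :
  integralOver chi w -> integralOver chi (w ^+ k).
Proof.
by move=> iw; elim: k => [|k IHk]; rewrite ?exprS; [exact: integral1|exact: integral_mul].
Qed.

Let psi_fraction c g : phi0 c != 0 -> exists e k, psi c g = phi0 e / phi0 c ^+ k.
Proof.
move=> c0; elim/poly_ind: g => [|g b [e [k IHg]]].
  by exists 0, 0%N; rewrite !rmorph0 mul0r.
exists (e + b * c ^+ k.+1), k.+1.
have -> : psi c (g * 'X + b%:P) = psi c g / phi0 c + phi0 b.
  by rewrite !psiE rmorphD rmorphM /= map_polyX map_polyC hornerMXaddC.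
rewrite IHg rmorphD rmorphM rmorphXn mulrDl mulfK ?expf_neq0 //.
by rewrite exprSr invfM mulrA.
Qed.

Variable phi : {rmorphism {poly R} -> L}.
Hypothesis phiC : forall r, phi r%:P = phi0 r.
Let z := phi 'X.

Let phiE p : phi p = (map_poly phi0 p).[z].
Proof.
elim/poly_ind: p => [|p c IHp]; first by rewrite !rmorph0 horner0.
by rewrite !rmorphD !rmorphM /= IHp phiC map_polyX map_polyC hornerMXaddC.
Qed.

Variable s : {poly R}.
Hypotheses (s0 : phi s != 0)
  (phis : forall a, phi a != 0 -> exists b k, phi a * phi b = phi s ^+ k).

(** If [z] were transcendental over the image of [R], the hypothesis on [s] could be read in the
    polynomial ring over [L]: [1 + X s] would divide a power of [s]. But it is coprime to [s] and
    not constant. *)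
Lemma goldman_algebraic : exists2 p, phi p = 0 & map_poly phi0 p != 0.
Proof.
apply: contrapT => nop.
have tr p : phi p = 0 -> map_poly phi0 p = 0.
  by move=> p0; apply/eqP; apply: contrapT => /negP p1; apply: nop; exists p.
pose u := 1 + 'X * s; set S := map_poly phi0 s.
have S0 : S != 0 by apply: contraNneq s0; rewrite phiE -/S => ->; rewrite horner0.
have uE : map_poly phi0 u = 1 + 'X * S.
  by rewrite rmorphD rmorphM rmorph1 /= map_polyX.
have szu : size (1 + 'X * S) = (size S).+1.
  rewrite mulrC addrC size_polyDl size_mulX // size_poly1 ltnS.
  by rewrite lt0n size_poly_eq0.
have phiu : phi u != 0.
  by apply/eqP => /tr /eqP; rewrite uE -size_poly_eq0 szu.
have [b [k]] := phis phiu; rewrite -rmorphM -rmorphXn => /eqP.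
rewrite -subr_eq0 -rmorphB => /eqP /tr ubs.
have uS : (1 + 'X * S) * map_poly phi0 b = S ^+ k.
  by apply/eqP; rewrite -uE /S -rmorphM -rmorphXn -subr_eq0 -rmorphB /= ubs.
have : coprimep (1 + 'X * S) (S ^+ k).
  apply: coprimep_expr; apply/Bezout_eq1_coprimepP; exists (1, - 'X) => /=.
  by rewrite mul1r mulNr addrK.
rewrite /coprimep (eqp_size (dvdp_gcd_idl _)) ?szu; last by rewrite -uS dvdp_mulIl.
by rewrite eqSS size_poly_eq0 (negPf S0).
Qed.

(** The witness is [a * e]: inverting the leading coefficient [a] of a relation for [z] makes [z]
    integral, and inverting [e] as well makes the inverse of [w = phi s] integral. The inverse of a
    nonzero [phi0 r] is then integral over the localization at [a * e], hence lies in it. *)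
Lemma goldman_base : exists c, phi0 c != 0 /\
  forall r, phi0 r != 0 -> exists b k, phi0 r * phi0 b = phi0 c ^+ k.
Proof.
have [p p0 P0] := goldman_algebraic; set P := map_poly phi0 p in P0.
pose a := p`_(size P).-1.
have aE : phi0 a = lead_coef P by rewrite lead_coefE coef_map.
have a0 : phi0 a != 0 by rewrite aE lead_coef_eq0.
have int_z c : integralOver (psi c) (phi0 a)^-1 -> integralOver (psi c) z.
  move=> inta; apply: (@integral_root_monic _ _ _ _ ((phi0 a)^-1 *: P)).
  - by rewrite monicE lead_coefZ -aE mulVf.
  - by rewrite rootZ ?invr_eq0 // /root -phiE p0.
  - apply/(integral_poly (psi c)) => i; rewrite coefZ coef_map.
    by apply: integral_mul => //; exact: integral_base.
have int_phi c q : integralOver (psi c) (phi0 a)^-1 -> integralOver (psi c) (phi q).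
  move=> inta; rewrite phiE; apply: integral_horner; last exact: int_z.
  by apply: integral_map => r; exact: integral_base.
pose w := phi s; have w0 : w != 0 by [].
(* Cancelling powers of [w] in an equation for [w] leaves a nonzero constant term [psi a c], and the
   equation can be solved for the inverse of [w]. *)
have strip (Q : {poly {poly R}}) : map_poly (psi a) Q != 0 ->
    (map_poly (psi a) Q).[w] = 0 -> exists (Q1 : {poly {poly R}}) c,
    psi a c != 0 /\ (map_poly (psi a) Q1).[w] * w + psi a c = 0.
  elim/poly_ind: Q => [|Q c IHQ]; first by rewrite rmorph0 eqxx.
  have -> : map_poly (psi a) (Q * 'X + c%:P) =
            map_poly (psi a) Q * 'X + (psi a c)%:P.
    by rewrite rmorphD rmorphM /= map_polyX map_polyC.
  rewrite hornerMXaddC; have [c0|c0] := eqVneq (psi a c) 0; last by exists Q, c.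
  rewrite c0 !addr0 mulf_eq0 polyX_eq0 orbF => Q0 /eqP.
  by rewrite mulf_eq0 (negPf w0) orbF => /eqP; exact: IHQ.
have [Q mon_Q rootQ] := int_phi a s (integral_inv_base a).
have Q0 : map_poly (psi a) Q != 0 by rewrite monic_neq0 // monic_map.
have [Q1 [c [c0 Qc]]] := strip Q Q0 (rootP rootQ).
have [e [k cE]] := psi_fraction c a0.
have e0 : phi0 e != 0 by apply: contraNneq c0 => e0; rewrite cE e0 mul0r.
have int_a := integral_inv_l a e0; have int_e := integral_inv_r e a0.
have int_w : integralOver (psi (a * e)) w^-1.
  have -> : w^-1 = - ((map_poly (psi a) Q1).[w] * (phi0 a ^+ k * (phi0 e)^-1)).
    apply: (mulIf w0); rewrite mulVf // mulNr -mulrA [_ * w]mulrC mulrA.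
    move/eqP: Qc; rewrite addr_eq0 => /eqP ->; rewrite mulNr opprK cE.
    by rewrite mulf_div [phi0 a ^+ k * _]mulrC divff // mulf_neq0 // expf_neq0.
  apply: integral_opp; apply: integral_mul; last first.
    by apply: integral_mul => //; apply: integralX; exact: integral_base.
  apply: integral_horner; last exact: int_phi.
  apply/(integral_poly (psi (a * e))) => i; rewrite coef_map.
  change (integralOver (psi (a * e)) (map_poly phi0 Q1`_i).[(phi0 a)^-1]).
  by apply: integral_horner => //; apply: integral_map => r; exact: integral_base.
exists (a * e); split=> [|r r0]; first by rewrite rmorphM mulf_neq0.
suff [g gE] : exists g, (phi0 r)^-1 = psi (a * e) g.
  have [|f [m fE]] := psi_fraction g (c := a * e); first by rewrite rmorphM mulf_neq0.
  exists f, m; move: gE; rewrite fE => /(congr1 ( *%R (phi0 r))); rewrite divff //.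
  rewrite mulrA => /(congr1 ( *%R^~ (phi0 (a * e) ^+ m))).
  by rewrite mul1r divfK // expf_neq0 // rmorphM mulf_neq0.
have [|b [m]] := phis (a := r%:P); rewrite phiC // => rb.
rewrite -(psiC (a * e) r); apply: integral_inv_in_range; rewrite psiC //.
have -> : (phi0 r)^-1 = phi b * w^-1 ^+ m.
  by apply: (mulfI r0); rewrite mulfV // mulrA rb exprVn mulfV // expf_neq0.
by apply: integral_mul; [exact: int_phi|exact: integralX].
Qed.

End GoldmanStep.

(** The constants have a finite image by the hypothesis on [R], so the leading coefficient of an
    algebraic relation for [phi 'X] is a root of unity. The relation becomes monic, and remainders
    modulo it take finitely many values. *)
Lemma goldman_finite_poly (R : comNzRingType) :
  goldman_finite R -> goldman_finite {poly R}.
Proof.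
move=> finR L phi s s0 phis.
have [phi0 phiC] : exists phi0 : {rmorphism R -> L}, forall r, phi r%:P = phi0 r.
  by exists (phi \o polyC).
have [c [c0 cP]] := goldman_base phiC s0 phis.
have phiE p : phi p = (map_poly phi0 p).[phi 'X].
  elim/poly_ind: p => [|p a IHp]; first by rewrite !rmorph0 horner0.
  by rewrite !rmorphD !rmorphM /= IHp phiC map_polyX map_polyC hornerMXaddC.
have fin0 : finite_pred (fun z => exists a, z = phi0 a).
  exact: (finR _ _ c).
have [p p0 P0] := goldman_algebraic phiC s0 phis; set P := map_poly phi0 p in P0.
pose a := p`_(size P).-1.
have aE : phi0 a = lead_coef P by rewrite lead_coefE coef_map.
have a0 : phi0 a != 0 by rewrite aE lead_coef_eq0.
have [N aN] : exists N, phi0 (a ^+ N) * phi0 a = 1.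
  have [|i [j [lt_ij aij]]] := finite_pred_pigeonhole (f := fun i => phi0 a ^+ i) fin0.
    by move=> n; exists (a ^+ n); rewrite rmorphXn.
  exists (j - i).-1; rewrite rmorphXn -exprSr prednK ?subn_gt0 //.
  by apply: (mulfI (expf_neq0 i a0)); rewrite -exprD subnKC ?(ltnW lt_ij) // mulr1 aij.
(* [p] may have a higher degree than its image [P]: its coefficients above [d] map to 0, and the one
   of degree [d], multiplied by [a ^+ N], maps to 1, so ['X^d] stands for all of them. *)
pose d := (size P).-1.
pose q0 : {poly R} := \poly_(i < d) (a ^+ N * p`_i).
pose q : {poly R} := 'X^d + q0.
have szq : (size q0 < size ('X^d : {poly R}))%N.
  by rewrite size_polyXn ltnS size_poly.
have mon_q : q \is monic by rewrite monicE lead_coefDl // lead_coefXn.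
have phiq : phi q = 0.
  rewrite -(mulr0 (phi0 (a ^+ N))) -p0 [phi p]phiE -hornerZ phiE; congr (_.[_]).
  apply/polyP => i; rewrite coefZ !coef_map /= coefD coefXn coef_poly rmorphD rmorph_nat.
  have [lt_id|lt_di|->] := ltngtP i d; rewrite ?add0r ?rmorph0 ?addr0 ?rmorphM //.
    have /leq_sizeP/(_ i) : (size P <= d.+1)%N by rewrite /d leqSpred.
    by rewrite coef_map => -> //; rewrite mulr0.
apply: finite_pred_sub (@finite_pred_sum _ d (fun i v =>
  exists t u : L, [/\ exists b, t = phi0 b, u = phi 'X ^+ i & v = t * u]) _) _.
  move=> i _; apply: finite_pred_map2 => //.
  by exists [:: phi 'X ^+ i] => _ ->; rewrite inE.
move=> _ [b ->]; pose r := rmodp b q.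
have szr : (size r <= d)%N.
  have szq' : size q = d.+1 by rewrite size_polyDl // size_polyXn.
  by rewrite -ltnS -szq' ltn_rmodp monic_neq0.
have -> : phi b = phi r.
  by rewrite {1}(rdivp_eq mon_q b) rmorphD rmorphM phiq mulr0 add0r.
exists (fun i => phi0 r`_i * phi 'X ^+ i).
  by move=> i _; exists (phi0 r`_i), (phi 'X ^+ i); split=> //; exists r`_i.
rewrite phiE (@horner_coef_wide _ d) ?(leq_trans (size_poly _ _)) //.
by apply: eq_bigr => i _; rewrite coef_map.
Qed.

(** * Hilbert's basis theorem *)

Definition noetherian (R : nzRingType) : Prop :=
  forall I : nat -> R -> Prop, (forall n, ideal (I n)) ->
    (forall n a, I n a -> I n.+1 a) ->
  exists N, forall n a, I n a -> I N a.

Lemma chain_mono (T : Type) (I : nat -> T -> Prop) :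
  (forall n a, I n a -> I n.+1 a) ->
  forall m n a, (m <= n)%N -> I m a -> I n a.
Proof.
move=> mono m n a /subnKC <-; elim: (n - m)%N => [|k IHk]; rewrite ?addn0 // addnS.
by move=> /IHk /mono.
Qed.

Lemma noetherian_int : noetherian int.
Proof.
move=> I iI mono; have le := chain_mono mono.
have [[n [a [Ia a0]]]|no] := pselect (exists n a, I n a /\ a <> 0); last first.
  exists 0%N => n a Ia; have [->|/eqP a0] := eqVneq a 0; first exact: ideal0.
  by exfalso; apply: no; exists n, a.
pose P m := `[< (0 < m)%N /\ exists n, I n m%:Z >].
have exP : exists m, P m.
  exists `|a|%N; apply/asboolP; split; first by rewrite absz_gt0; apply/eqP.
  by exists n; rewrite abszE; case: (ger0P a) => _ //; exact: idealN.
case: (ex_minnP exP) => m /asboolP[m_gt0 [N Im]] min_m.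
exists N => k b Ib; rewrite (divz_eq b m%:Z).
suff -> : (b %% m = 0)%Z by rewrite addr0; exact: (idealMl (iI _)).
apply/eqP; apply: contrapT => /negP r0.
have m0 : m%:Z != 0 by rewrite eqz_nat -lt0n.
have r_ge0 : (0 <= b %% m)%Z by rewrite modz_ge0.
have : (m <= `|(b %% m)%Z|)%N.
  apply: min_m; apply/asboolP; split; first by rewrite absz_gt0.
  exists (maxn N k); rewrite gez0_abs // /modz; apply: (idealB (iI _)) => //.
    exact: le (leq_maxr _ _) Ib.
  by apply: (idealMl (iI _)); exact: le (leq_maxl _ _) Im.
by rewrite -lez_nat gez0_abs // leNgt ltz_pmod // ltz_nat.
Qed.

(** Hilbert's argument. The ideals [LC n d] of leading coefficients grow in both indices; the
    diagonal stabilizes from [N0] on, and the finitely many rows [d < N0] stabilize separately.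
    Beyond the common bound [M], subtracting an element of [I M] lowers the size. *)
Lemma noetherian_poly (R : comNzRingType) : noetherian R -> noetherian {poly R}.
Proof.
move=> noeR I iI mono; have le := chain_mono mono.
pose LC n d a := exists p, [/\ I n p, (size p <= d.+1)%N & p`_d = a].
have iLC n d : ideal (LC n d).
  split=> [|_ _ [p [Ip sp <-]] [q [Iq sq <-]]|r _ [p [Ip sp <-]]|r _ [p [Ip sp <-]]].
  - by exists 0; rewrite size_poly0 coef0; split=> //; exact: ideal0.
  - exists (p - q); rewrite coefB; split=> //; first exact: (idealB (iI _)).
    by rewrite (leq_trans (size_polyD _ _)) // size_polyN geq_max sp.
  - exists (r *: p); rewrite coefZ; split=> //; last exact: leq_trans (size_scale_leq _ _) sp.
    by rewrite -mul_polyC; exact: (idealMl (iI _)).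
  - exists (r *: p); rewrite coefZ mulrC; split=> //.
      by rewrite -mul_polyC; exact: (idealMl (iI _)).
    exact: leq_trans (size_scale_leq _ _) sp.
have LCn n d a : LC n d a -> LC n.+1 d a.
  by move=> [p [Ip sp <-]]; exists p; split=> //; exact: mono.
have LCd n d a : LC n d a -> LC n d.+1 a.
  move=> [p [Ip sp <-]]; exists (p * 'X); rewrite coefMX; split=> //.
    exact: (idealMr (iI _)).
  by rewrite (leq_trans (size_polyMleq _ _)) // size_polyX addn2 ltnS.
have leLC m n d e a : (m <= n)%N -> (d <= e)%N -> LC m d a -> LC n e a.
  move=> le_mn le_de /(chain_mono (fun n => LCn n d) le_mn).
  exact: (chain_mono (LCd n) le_de).
have [N0 N0P] := noeR (fun n => LC n n) (fun n => iLC n n)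
   (fun n a H => LCd n.+1 n a (LCn n n a H)).
have [N NP] : {N : nat -> nat & forall d n a, LC n d a -> LC (N d) d a}.
  by apply: (@choice _ _ (fun d m => forall n a, LC n d a -> LC m d a)) => d;
     exact: (noeR (fun n => LC n d) (fun n => iLC n d) (fun n a => @LCn n d a)).
pose M := maxn N0 (\max_(d < N0) N d).
have LCM n d a : LC n d a -> LC M d a.
  move=> Ha; have [lt_d|le_d] := ltnP d N0.
    apply: (leLC (N d) _ d) (NP _ _ _ Ha) => //.
    exact: leq_trans (leq_bigmax (Ordinal lt_d)) (leq_maxr _ _).
  apply: (leLC N0 _ N0) => //; first exact: leq_maxl.
  apply: (N0P (maxn n d)); apply: leLC Ha; [exact: leq_maxl|exact: leq_maxr].
exists M => n p; elim: {p}_.+1 {-2}p (ltnSn (size p)) n => // k IHk p.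
rewrite ltnS => sp n Ip; case: k => [|k] in IHk sp *.
  by move: sp; rewrite leqn0 size_poly_eq0 => /eqP ->; exact: ideal0.
have [|q [Iq sq qp]] := LCM n k p`_k; first by exists p.
rewrite -(subrK q p); apply: (idealD (iI _)) => //; apply: (IHk _ _ (maxn n M)).
  rewrite ltnS; apply/leq_sizeP => j; rewrite leq_eqVlt coefB => /predU1P[<-|lt_kj].
    by rewrite qp subrr.
  by rewrite !nth_default ?subrr ?(leq_trans sp) ?(leq_trans sq).
by apply: (idealB (iI _)) => //; [exact: le (leq_maxl _ _) Ip|exact: le (leq_maxr _ _) Iq].
Qed.

(** * Square-zero hearts *)

Section QuotientField.
Variables (R : comNzRingType) (M : R -> Prop) (Q : nzRingType) (pi : R -> Q).
Hypothesis qpi : subquotient_map (fun _ => True) M pi.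
Hypothesis invM : forall a, ~ M a -> exists b, M (b * a - 1).

Definition quotient_field : Type := Q.
HB.instance Definition _ := GRing.NzRing.on quotient_field.

Let mulC : commutative (@GRing.mul quotient_field).
Proof.
move=> p q; have [a _ <-] := sq_onto qpi p; have [b _ <-] := sq_onto qpi q.
by rewrite -!(sqM qpi) // mulrC.
Qed.

HB.instance Definition _ :=
  GRing.PzSemiRing_hasCommutativeMul.Build quotient_field mulC.

Let inv_exists (q : quotient_field) :
  {r : quotient_field | (q != 0 -> r * q = 1) /\ (q = 0 -> r = 0)}.
Proof.
apply: cid; have [->|q0] := eqVneq q 0; first by exists 0.
have [a _ aq] := sq_onto qpi q.
have [|b Mb] := invM (a := a).
  by move=> Ma; case/eqP: q0; rewrite -aq; apply/(sq_eq0 qpi).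
exists (pi b); split=> [_|/eqP]; last by rewrite (negPf q0).
apply/eqP; rewrite -subr_eq0 -aq -(sq1 qpi) -(sqM qpi) // -(sqB qpi) //.
exact/eqP/(sq_eq0 qpi).
Qed.

Let inv (q : quotient_field) := sval (inv_exists q).
Let mulVq (q : quotient_field) : q != 0 -> inv q * q = 1.
Proof. exact: (svalP (inv_exists q)).1. Qed.
Let inv0 : inv 0 = 0.
Proof. exact: (svalP (inv_exists 0)).2. Qed.

HB.instance Definition _ := GRing.ComNzRing_isField.Build quotient_field mulVq inv0.

Definition quotient_field_pi (a : R) : quotient_field := pi a.

Let pi_zmod : zmod_morphism quotient_field_pi.
Proof. by move=> a b; apply: (sqB qpi). Qed.
Let pi_monoid : monoid_morphism quotient_field_pi.
Proof. by split=> [|a b]; [exact: sq1 qpi|apply: (sqM qpi)]. Qed.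

HB.instance Definition _ := GRing.isZmodMorphism.Build R quotient_field
  quotient_field_pi pi_zmod.
HB.instance Definition _ := GRing.isMonoidMorphism.Build R quotient_field
  quotient_field_pi pi_monoid.

Lemma quotient_field_piP : exists (L : fieldType) (phi : {rmorphism R -> L}),
  (forall a, phi a = 0 <-> M a) /\ forall z, exists a, z = phi a.
Proof.
exists (quotient_field : fieldType), (quotient_field_pi : {rmorphism R -> quotient_field}).
by split=> [a|z]; [exact: sq_eq0 qpi a I|have [a _ <-] := sq_onto qpi z; exists a].
Qed.

End QuotientField.

Lemma field_quotient (R : comNzRingType) (M : R -> Prop) :
    ideal M -> ~ M 1 -> (forall a, ~ M a -> exists b, M (b * a - 1)) ->
  exists (L : fieldType) (phi : {rmorphism R -> L}),
    (forall a, phi a = 0 <-> M a) /\ forall z, exists a, z = phi a.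
Proof.
move=> iM M1 invM; have [//|Q [pi qpi]] := subquotient_exists (subringT R) (ideal_ofT iM).
exact: quotient_field_piP qpi invM.
Qed.

(** * Modules over iterated polynomial rings *)

Record is_action (R : nzRingType) (V : zmodType) (N : V -> Prop)
    (rho : R -> V -> V) : Prop := IsAction {
  act_in : forall a n, N n -> N (rho a n);
  act_Dl : forall a b n, N n -> rho (a + b) n = rho a n + rho b n;
  act_Dr : forall a m n, N m -> N n -> rho a (m + n) = rho a m + rho a n;
  act_1 : forall n, N n -> rho 1 n = n;
  act_M : forall a b n, N n -> rho (a * b) n = rho a (rho b n) }.

Record commutes_with (R : nzRingType) (V : zmodType) (N : V -> Prop)
    (rho : R -> V -> V) (T : V -> V) : Prop := CommutesWith {
  cw_in : forall n, N n -> N (T n);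
  cw_D : forall m n, N m -> N n -> T (m + n) = T m + T n;
  cw_comm : forall a n, N n -> T (rho a n) = rho a (T n) }.

(** The variable acts as [T] and the coefficients as before. Iterating the extension turns commuting
    operators into a module over a polynomial ring in several variables. *)
Definition poly_act (R : nzRingType) (V : zmodType) (rho : R -> V -> V) (T : V -> V)
    (p : {poly R}) (n : V) : V :=
  \sum_(i < size p) rho p`_i (iter i T n).

Section PolyAction.
Variables (R : nzRingType) (V : zmodType) (N : V -> Prop).
Variables (rho : R -> V -> V) (T : V -> V).
Hypotheses (N0 : N 0) (ND : forall m n, N m -> N n -> N (m + n)).
Hypotheses (rhoP : is_action N rho) (TP : commutes_with N rho T).

Local Notation act := (poly_act rho T).

Let rho0l n : N n -> rho 0 n = 0.
Proof.
move=> Nn; apply: (addrI (rho 0 n)); rewrite addr0 -(act_Dl rhoP) //.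
by rewrite addr0.
Qed.

Let rho0r a : rho a 0 = 0.
Proof. by apply: (addrI (rho a 0)); rewrite -(act_Dr rhoP) // !addr0. Qed.

Let NT i n : N n -> N (iter i T n).
Proof. by move=> Nn; elim: i => //= i IHi; exact: cw_in TP _ IHi. Qed.

Let N_sum m (F : nat -> V) : (forall i, N (F i)) -> N (\sum_(i < m) F i).
Proof. by move=> NF; apply: big_ind => // i _; exact: NF. Qed.

Lemma poly_act_wide m (p : {poly R}) n : N n -> (size p <= m)%N ->
  act p n = \sum_(i < m) rho p`_i (iter i T n).
Proof.
move=> Nn le_pm; rewrite /poly_act (big_ord_widen m (fun i => rho p`_i (iter i T n))) //.
rewrite big_mkcond /=; apply: eq_bigr => i _; case: ltnP => // le_pi.
by rewrite nth_default // rho0l //; exact: NT.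
Qed.

Lemma poly_act_in p n : N n -> N (act p n).
Proof.
move=> Nn; apply: (@N_sum _ (fun i => rho p`_i (iter i T n))) => i.
exact: (act_in rhoP) _ _ (NT i Nn).
Qed.

Lemma poly_act_Dl p q n : N n -> act (p + q) n = act p n + act q n.
Proof.
move=> Nn; pose m := maxn (size p) (size q).
rewrite !(@poly_act_wide m) ?leq_maxl ?leq_maxr ?size_polyD // -big_split /=.
by apply: eq_bigr => i _; rewrite coefD (act_Dl rhoP) //; exact: NT.
Qed.

Let TD i m n : N m -> N n -> iter i T (m + n) = iter i T m + iter i T n.
Proof.
by move=> Nm Nn; elim: i => //= i ->; rewrite (cw_D TP) //; exact: NT.
Qed.

Lemma poly_act_Dr p m n : N m -> N n -> act p (m + n) = act p m + act p n.
Proof.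
move=> Nm Nn; rewrite /poly_act -big_split /=; apply: eq_bigr => i _.
by rewrite TD // (act_Dr rhoP) //; exact: NT.
Qed.

Lemma poly_actC a n : N n -> act a%:P n = rho a n.
Proof.
by move=> Nn; rewrite (@poly_act_wide 1) ?size_polyC ?leq_b1 // big_ord1 coefC.
Qed.

Lemma poly_actMX p n : N n -> act (p * 'X) n = act p (T n).
Proof.
move=> Nn; rewrite (@poly_act_wide (size p).+1) //; last first.
  by rewrite (leq_trans (size_polyMleq _ _)) // size_polyX addn2.
rewrite big_ord_recl coefMX eqxx rho0l // add0r.
by apply: eq_bigr => i _; rewrite coefMX /= -iterSr.
Qed.

Lemma poly_actX n : N n -> act 'X n = T n.
Proof.
move=> Nn; have NTn := cw_in TP Nn.
by rewrite -['X]mul1r poly_actMX // -polyC1 poly_actC // (act_1 rhoP).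
Qed.

Let rho_sum m a (F : nat -> V) : (forall i, N (F i)) ->
  rho a (\sum_(i < m) F i) = \sum_(i < m) rho a (F i).
Proof.
move=> NF; elim: m => [|m IHm]; first by rewrite !big_ord0 rho0r.
by rewrite !big_ord_recr (act_Dr rhoP) ?IHm //; exact: N_sum.
Qed.

Let actCM a q n : N n -> act (a%:P * q) n = rho a (act q n).
Proof.
move=> Nn; rewrite (@poly_act_wide (size q)) //; last first.
  by rewrite mul_polyC size_scale_leq.
rewrite /poly_act (@rho_sum _ _ (fun i => rho q`_i (iter i T n))) => [|i]; last exact: (act_in rhoP) _ _ (NT i Nn).
by apply: eq_bigr => i _; rewrite coefCM (act_M rhoP) //; exact: NT.
Qed.

Let act0 n : act 0 n = 0.
Proof. by rewrite /poly_act size_poly0 big_ord0. Qed.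

Let T0 : T 0 = 0.
Proof. by apply: (addrI (T 0)); rewrite -(cw_D TP) // !addr0. Qed.

Lemma poly_act_commutes (U : V -> V) :
    commutes_with N rho U -> (forall n, N n -> U (T n) = T (U n)) ->
  commutes_with N act U.
Proof.
move=> UP UT; split; [exact: cw_in UP|exact: cw_D UP|move=> p n Nn].
have U0 : U 0 = 0 by apply: (addrI (U 0)); rewrite -(cw_D UP) // !addr0.
have Usum m (F : nat -> V) : (forall i, N (F i)) ->
    U (\sum_(i < m) F i) = \sum_(i < m) U (F i).
  move=> NF; elim: m => [|m IHm]; first by rewrite !big_ord0 U0.
  by rewrite !big_ord_recr (cw_D UP) ?IHm //; exact: N_sum.
rewrite /poly_act (Usum _ (fun i => rho p`_i (iter i T n))) => [|i].
  apply: eq_bigr => i _; rewrite (cw_comm UP) //; last exact: NT.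
  congr (rho _ _); elim: (nat_of_ord i) => //= k IHk.
  by rewrite UT ?IHk //; exact: NT.
exact: (act_in rhoP) _ _ (NT i Nn).
Qed.

Lemma poly_act_action : is_action N act.
Proof.
split; [exact: poly_act_in|exact: poly_act_Dl|exact: poly_act_Dr| |].
  by move=> n Nn; rewrite -polyC1 poly_actC // (act_1 rhoP).
have TPT : commutes_with N act T by exact: poly_act_commutes.
move=> p q; elim/poly_ind: p => [|p c IHp] n Nn; first by rewrite mul0r !act0.
have Nq := poly_act_in q Nn; have NTn := cw_in TP Nn.
rewrite mulrDl !poly_act_Dl // actCM // poly_actC // poly_actMX //.
rewrite -mulrA -commr_polyX mulrA poly_actMX // IHp //.
by rewrite (cw_comm TPT).
Qed.

End PolyAction.

Section SquareZeroHeart.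
Variables (R : nzRingType) (x y : R).
Hypothesis gen : generated_by x y.
Let c := x * y - y * x.
Let H := @in_heart R.
Hypotheses (c0 : c <> 0) (Hc : H c).
Hypothesis HH : forall h k, H h -> H k -> h * k = 0.

Let iH : ideal H := ideal_heart R.
Let H0 : H 0 := ideal0 iH.
Let HD h k : H h -> H k -> H (h + k). Proof. exact: (idealD iH). Qed.
Let Hcomm u v : H (u * v - v * u). Proof. exact: (commutators_in_ideal gen iH Hc). Qed.

(** All commutators lie in [H], which has square zero, so left multiplications commute with each
    other on [H]; the right ones do for the same reason. *)
Let commL u v h : H h -> u * (v * h) = v * (u * h).
Proof.
by move=> Hh; apply/eqP; rewrite -subr_eq0 !mulrA -mulrBl (HH (Hcomm _ _) Hh).
Qed.

Let commR u v h : H h -> h * u * v = h * v * u.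
Proof.
by move=> Hh; apply/eqP; rewrite -subr_eq0 -!mulrA -mulrBr (HH Hh (Hcomm _ _)).
Qed.

(** From the innermost outwards, the four variables act by left multiplication by [x] and [y], then
    by right multiplication by [x] and [y]; [rho4] is the action of Z[X1, Y1, X2, Y2] on [H]. *)
Let rho0 (z : int) (h : R) := h *~ z.
Let rho1 := poly_act rho0 ( *%R x).
Let rho2 := poly_act rho1 ( *%R y).
Let rho3 := poly_act rho2 ( *%R^~ x).
Let rho4 := poly_act rho3 ( *%R^~ y).

Let rho0P : is_action H rho0.
Proof.
split=> [a n Hn|a b n _|a m n _ _|n _|a b n _]; rewrite /rho0.
- by rewrite -mulrzl; exact: (idealMl iH).
- by rewrite mulrzDr.
- by rewrite mulrzDl.
- by rewrite mulr1z.
- by rewrite mulrC mulrzA.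
Qed.

Let lmul0 u : commutes_with H rho0 ( *%R u).
Proof.
split=> [n Hn|m n _ _|a n _]; [exact: (idealMl iH)|exact: mulrDr|].
by rewrite /rho0 mulrzAr.
Qed.

Let rmul0 u : commutes_with H rho0 ( *%R^~ u).
Proof.
split=> [n Hn|m n _ _|a n _]; [exact: (idealMr iH)|exact: mulrDl|].
by rewrite /rho0 mulrzAl.
Qed.

Let rho1P : is_action H rho1. Proof. exact: (poly_act_action H0 HD). Qed.
Let lmul1 u : commutes_with H rho1 ( *%R u).
Proof. by apply: (poly_act_commutes H0 HD) => // n Hn; exact: commL. Qed.
Let rmul1 u : commutes_with H rho1 ( *%R^~ u).
Proof. by apply: (poly_act_commutes H0 HD) => // n Hn; rewrite mulrA. Qed.

Let rho2P : is_action H rho2. Proof. exact: (poly_act_action H0 HD). Qed.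
Let rmul2 u : commutes_with H rho2 ( *%R^~ u).
Proof. by apply: (poly_act_commutes H0 HD) => // n Hn; rewrite mulrA. Qed.

Let rho3P : is_action H rho3. Proof. exact: (poly_act_action H0 HD). Qed.
Let rmul3 u : commutes_with H rho3 ( *%R^~ u).
Proof. by apply: (poly_act_commutes H0 HD) => // n Hn; exact: commR. Qed.

Let rho4P : is_action H rho4. Proof. exact: (poly_act_action H0 HD). Qed.

Let lxE h : H h -> rho4 'X%:P%:P%:P h = x * h.
Proof.
move=> Hh; rewrite /rho4 (poly_actC rho3P (rmul3 y)) // /rho3.
rewrite (poly_actC rho2P (rmul2 x)) // /rho2 (poly_actC rho1P (lmul1 y)) //.
by rewrite /rho1 (poly_actX rho0P (lmul0 x)).
Qed.

Let lyE h : H h -> rho4 'X%:P%:P h = y * h.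
Proof.
move=> Hh; rewrite /rho4 (poly_actC rho3P (rmul3 y)) // /rho3.
by rewrite (poly_actC rho2P (rmul2 x)) // /rho2 (poly_actX rho1P (lmul1 y)).
Qed.

Let rxE h : H h -> rho4 'X%:P h = h * x.
Proof.
move=> Hh; rewrite /rho4 (poly_actC rho3P (rmul3 y)) //.
by rewrite /rho3 (poly_actX rho2P (rmul2 x)).
Qed.

Let ryE h : H h -> rho4 'X h = h * y.
Proof. by move=> Hh; rewrite /rho4 (poly_actX rho3P (rmul3 y)). Qed.

Let E h v := exists P, v = rho4 P h.

Let EB h u v : H h -> E h u -> E h v -> E h (u - v).
Proof.
move=> Hh [P ->] [Q ->]; exists (P - Q); apply: (addIr (rho4 Q h)).
by rewrite -(act_Dl rho4P) // !subrK.
Qed.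

Let EM h P v : H h -> E h v -> E h (rho4 P v).
Proof. by move=> Hh [Q ->]; exists (P * Q); rewrite (act_M rho4P). Qed.

Let EH h v : H h -> E h v -> H v.
Proof. by move=> Hh [P ->]; exact: act_in rho4P _ _ Hh. Qed.

(** The elements whose left, or right, multiplication preserves the cyclic submodule [E h] form a
    subring containing [x] and [y]. *)
Let E_ideal h : H h -> ideal (E h).
Proof.
move=> Hh.
have E0 : E h 0 by rewrite -(subrr (rho4 1 h)); apply: EB => //; exists 1.
split=> //; first by move=> a b; exact: EB.
- apply: gen; [split=> [v|a b Ea Eb v Ev|a b Ea Eb v Ev]|move=> v Ev|move=> v Ev].
  + by rewrite mul1r.
  + by rewrite mulrBl; apply: EB; auto.
  + by rewrite -mulrA; auto.
  + by rewrite -lxE; [exact: EM|exact: EH Ev].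
  + by rewrite -lyE; [exact: EM|exact: EH Ev].
- apply: gen; [split=> [v|a b Ea Eb v Ev|a b Ea Eb v Ev]|move=> v Ev|move=> v Ev].
  + by rewrite mulr1.
  + by rewrite mulrBr; apply: EB; auto.
  + by rewrite mulrA; auto.
  + by rewrite -rxE; [exact: EM|exact: EH Ev].
  + by rewrite -ryE; [exact: EM|exact: EH Ev].
Qed.

Let E1 h : H h -> E h h.
Proof. by move=> Hh; exists 1; rewrite (act_1 rho4P). Qed.

(** Each nonzero [rho4 P c] generates a nonzero ideal, which contains [c]; so the annihilator [M] of
    [c] is maximal. Its quotient field is finitely generated as a ring, hence finite by the
    Nullstellensatz, and it maps onto [E c], which contains [H]. *)
Lemma heart_finite : finite_pred H.
Proof.
pose M P := rho4 P c = 0.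
have Mdiff P Q : rho4 P c = rho4 Q c <-> M (P - Q).
  have -> : rho4 P c = rho4 (P - Q) c + rho4 Q c.
    by rewrite -(act_Dl rho4P) ?subrK.
  by split=> [|->]; [rewrite -[X in _ = X]add0r => /addIr|rewrite add0r].
have rho4_0 P : rho4 P 0 = 0.
  by apply: (addrI (rho4 P 0)); rewrite -(act_Dr rho4P) // !addr0.
have iM : ideal M.
  split=> [|P Q MP MQ|P Q MQ|P Q MP].
  - by rewrite -(subrr 1); apply/Mdiff.
  - by apply/Mdiff; rewrite MP MQ.
  - by rewrite /M (act_M rho4P) // MQ.
  - by rewrite /M mulrC (act_M rho4P) // MP.
have [||L [phi [phi0 phi_onto]]] := field_quotient iM.
- by rewrite /M (act_1 rho4P).
- move=> P MP; set h := rho4 P c in MP.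
  have Hh : H h by exact: act_in rho4P _ _ Hc.
  have [Q cE] : E h c by apply: Hc (E_ideal Hh) _ (E1 Hh) MP.
  by exists Q; apply/Mdiff; rewrite (act_M rho4P) // (act_1 rho4P).
have finL : finite_pred (fun z => exists P, z = phi P).
  have gP := goldman_finite_poly (goldman_finite_poly (goldman_finite_poly
     (goldman_finite_poly goldman_finite_int))).
  apply: (gP _ _ 1); first by rewrite rmorph1 oner_eq0.
  move=> P P0; have [Q QE] := phi_onto (phi P)^-1; exists Q, 0%N.
  by rewrite -QE mulfV // expr0.
have finE : finite_pred (E c).
  apply: (finite_pred_image (f := fun z v => exists2 P, z = phi P & v = rho4 P c) finL).
    by move=> v [P ->]; exists (phi P); exists P.
  move=> z u v _ _ [P -> ->] [Q PQ ->]; apply/Mdiff/phi0.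
  by rewrite rmorphB PQ subrr.
by apply: finite_pred_sub finE _ => h Hh; exact: (Hh _ (E_ideal Hc) _ (E1 Hc) c0).
Qed.

(** The elements of [H] satisfying [P] form an ideal containing the nonzero [c], and such an ideal
    contains [H]. *)
Let heart_ind (P : R -> Prop) : P c -> P 0 ->
  (forall a b, H a -> H b -> P a -> P b -> P (a - b)) ->
  (forall r a, H a -> P a -> P (r * a)) -> (forall r a, H a -> P a -> P (a * r)) ->
  forall h, H h -> P h.
Proof.
move=> Pc P0 PB Pl Pr h Hh; suff [] : H h /\ P h by [].
apply: (Hh (fun h => H h /\ P h) _ c) => //.
split=> // [a b [Ha Pa] [Hb Pb]|r a [Ha Pa]|r a [Ha Pa]]; split; auto.
- exact: (idealB iH).
- exact: (idealMl iH).
- exact: (idealMr iH).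
Qed.

Let kill_left z : exists i j, (i < j)%N /\ forall h, H h -> (z ^+ j - z ^+ i) * h = 0.
Proof.
have [|i [j [lt_ij zij]]] := finite_pred_pigeonhole (f := fun i => z ^+ i * c) heart_finite.
  by move=> n; exact: (idealMl iH).
exists i, j; split=> //; apply: heart_ind.
- by rewrite mulrBl zij subrr.
- by rewrite mulr0.
- by move=> a b _ _ za zb; rewrite mulrBr za zb subrr.
- by move=> r a Ha za; rewrite commL // za mulr0.
- by move=> r a _ za; rewrite mulrA za mul0r.
Qed.

Let kill_right z : exists i j, (i < j)%N /\ forall h, H h -> h * (z ^+ j - z ^+ i) = 0.
Proof.
have [|i [j [lt_ij zij]]] := finite_pred_pigeonhole (f := fun i => c * z ^+ i) heart_finite.
  by move=> n; exact: (idealMr iH).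
exists i, j; split=> //; apply: heart_ind.
- by rewrite mulrBr zij subrr.
- by rewrite mul0r.
- by move=> a b _ _ za zb; rewrite mulrBl za zb subrr.
- by move=> r a _ za; rewrite -mulrA za mulr0.
- by move=> r a Ha za; rewrite commR // za mul0r.
Qed.

Let intr_comm (p : {poly int}) (z : R) : comm_poly (map_poly intr p) z.
Proof.
rewrite /comm_poly; elim/poly_ind: p => [|p a IHp].
  by rewrite rmorph0 horner0 mulr0 mul0r.
rewrite rmorphD rmorphM /= map_polyX map_polyC hornerMXaddC mulrDr mulrDl.
by rewrite mulrA IHp [z * _]commr_int.
Qed.

Let ev1 (p : {poly int}) : R := (map_poly intr p).[x].
(** Evaluation of a commutative polynomial with the powers of [x] to the left of those of [y]; it is
    additive, and multiplicative modulo [H]. *)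
Let ev (P : {poly {poly int}}) : R := (map_poly ev1 P).[y].

Let ev1_zmod : zmod_morphism ev1.
Proof. by move=> p q; rewrite /ev1 rmorphB hornerD hornerN. Qed.
HB.instance Definition _ := GRing.isZmodMorphism.Build {poly int} R ev1 ev1_zmod.

Let ev1M p q : ev1 (p * q) = ev1 p * ev1 q.
Proof. by rewrite /ev1 rmorphM /= hornerM_comm //; exact: intr_comm. Qed.

Let ev1_1 : ev1 1 = 1. Proof. by rewrite /ev1 rmorph1 hornerC. Qed.

Let evB P Q : ev (P - Q) = ev P - ev Q.
Proof. by rewrite /ev raddfB hornerD hornerN. Qed.

Let evMXaddC P p : ev (P * 'X + p%:P) = ev P * y + ev1 p.
Proof.
rewrite /ev -hornerMXaddC; congr (_.[_]); apply/polyP => i.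
by rewrite coef_map /= !coefD !coefMX !coefC coef_map raddfD /=; case: i => [|i] /=;
  rewrite ?raddf0.
Qed.

Let evC p : ev p%:P = ev1 p.
Proof. by rewrite -[p%:P]add0r -(mul0r 'X) evMXaddC /ev raddf0 horner0 mul0r add0r. Qed.

Let evCM p Q : ev (p%:P * Q) = ev1 p * ev Q.
Proof.
rewrite /ev; have -> : map_poly ev1 (p%:P * Q) = (ev1 p)%:P * map_poly ev1 Q.
  by apply/polyP => i; rewrite coefCM !coef_map /= coefCM ev1M.
by rewrite mul_polyC hornerZ.
Qed.

Let evD P Q : ev (P + Q) = ev P + ev Q.
Proof. by rewrite /ev raddfD hornerD. Qed.

Let evM P Q : H (ev (P * Q) - ev P * ev Q).
Proof.
elim/poly_ind: P => [|P p IHP].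
  by rewrite mul0r /ev raddf0 horner0 mul0r subrr.
rewrite mulrDl -mulrA -commr_polyX mulrA evD evCM evMXaddC.
have -> : ev (P * Q * 'X) = ev (P * Q) * y.
  by rewrite -[P * Q * 'X]addr0 -polyC0 evMXaddC raddf0 addr0.
have -> : ev (P * Q) * y + ev1 p * ev Q - (ev P * y + ev1 p) * ev Q =
   (ev (P * Q) - ev P * ev Q) * y + ev P * (ev Q * y - y * ev Q).
  rewrite [in LHS]mulrDl opprD addrACA subrr addr0 mulrBl mulrBr !mulrA.
  by rewrite addrA subrK.
by apply: HD; [exact: (idealMr iH)|exact: (idealMl iH)].
Qed.

Let ev_onto r : exists P, H (r - ev P).
Proof.
move: r; apply: gen.
- split=> [|a b [P aP] [Q bQ]|a b [P aP] [Q bQ]].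
  + by exists 1; rewrite -polyC1 evC ev1_1 subrr.
  + exists (P - Q); rewrite evB.
    have -> : a - b - (ev P - ev Q) = (a - ev P) - (b - ev Q).
      by rewrite !opprB addrACA [RHS]addrACA [- b - _]addrC.
    exact: (idealB iH).
  + exists (P * Q).
    have -> : a * b - ev (P * Q) =
        ((a - ev P) * b + ev P * (b - ev Q)) - (ev (P * Q) - ev P * ev Q).
      by rewrite mulrBl mulrBr addrA subrK opprB addrA subrK.
    apply: (idealB iH) => //; apply: HD; [exact: (idealMr iH)|exact: (idealMl iH)].
- by exists 'X%:P; rewrite evC /ev1 map_polyX hornerX subrr.
- exists 'X; rewrite -['X]addr0 -['X]mul1r -polyC0 evMXaddC raddf0 addr0.
  by rewrite -polyC1 evC ev1_1 mul1r subrr.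
Qed.

(** As [f] kills [H], the sets [J n] of polynomials [P] with [f^(n+1) ev P = 0] are ideals of
    Z[X, Y], and their chain stops at some [N]. If no power of [f] vanished, [c] would equal
    [f^(N+1) ev P] for some [P]; then [f c = 0] puts [P] in [J (N+1)], hence in [J N], and
    [c = 0]. *)
Let nilpotent_central f : (forall r, f * r = r * f) -> (forall h, H h -> f * h = 0) ->
  exists N, f ^+ N = 0.
Proof.
move=> cf fH; apply: contrapT => nil.
have cfn n r : f ^+ n * r = r * f ^+ n.
  by apply: commr_sym; apply: commrX; rewrite /GRing.comm cf.
pose J n P := f ^+ n.+1 * ev P = 0.
have fnH n h : H h -> f ^+ n.+1 * h = 0.
  by move=> Hh; rewrite exprSr -mulrA fH // mulr0.
have JM n P Q : J n P -> J n (Q * P).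
  move=> JP; rewrite /J -(subrK (ev Q * ev P) (ev (Q * P))) mulrDr fnH // add0r.
  by rewrite mulrA cfn -mulrA JP mulr0.
have [n|n P JP|N NP] := noetherian_poly (noetherian_poly noetherian_int) (I := J).
- split=> [|P Q JP JQ|Q P JP|Q P JP].
  + by rewrite /J /ev raddf0 horner0 mulr0.
  + by rewrite /J evB mulrBr JP JQ subrr.
  + exact: JM.
  + by rewrite mulrC; exact: JM.
- by rewrite /J exprS -mulrA JP mulr0.
have [r cE] : exists r, c = f ^+ N.+1 * r.
  apply: (Hc (I := fun t => exists r, t = f ^+ N.+1 * r) _ (a := f ^+ N.+1)).
  - split=> [|_ _ [r ->] [s ->]|s _ [r ->]|s _ [r ->]].
    + by exists 0; rewrite mulr0.
    + by exists (r - s); rewrite mulrBr.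
    + by exists (s * r); rewrite mulrA -cfn mulrA.
    + by exists (r * s); rewrite mulrA.
  - by exists 1; rewrite mulr1.
  - by move=> fN; apply: nil; exists N.+1.
have [P rP] := ev_onto r.
have cE' : c = f ^+ N.+1 * ev P by rewrite cE -{1}(subrK (ev P) r) mulrDr fnH ?add0r.
have : J N P by apply: (NP N.+1); rewrite /J exprS -mulrA -cE' fH.
by rewrite /J -cE'.
Qed.

(** [f = (z^j - z^i)(z^l - z^k)] kills [H] on both sides, and [f^2 r - r f^2 = f [f, r] + [f, r] f]
    with [[f, r]] in [H]. So [f^2] is central and kills [H]; it is nilpotent, and a power of [g * g]
    is the required monic polynomial. *)
Let integral_nilpotent z : exists2 q : {poly int}, q \is monic & (map_poly (intr : int -> R) q).[z] = 0.
Proof.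
have [i [j [lt_ij zl]]] := kill_left z; have [k [l [lt_kl zr]]] := kill_right z.
pose g : {poly int} := ('X^j - 'X^i) * ('X^l - 'X^k).
have mon_sub m n : (m < n)%N -> ('X^n - 'X^m : {poly int}) \is monic.
  by move=> lt_mn; rewrite monicE lead_coefDl ?size_polyN ?size_polyXn // lead_coefXn.
have evalM p q : (map_poly (intr : int -> R) (p * q)).[z] = (map_poly intr p).[z] * (map_poly intr q).[z].
  by rewrite rmorphM /= hornerM_comm //; exact: intr_comm.
pose f := (map_poly (intr : int -> R) g).[z].
have gE : f = (z ^+ j - z ^+ i) * (z ^+ l - z ^+ k).
  by rewrite /f evalM !rmorphB /= !map_polyXn !hornerD !hornerN !hornerXn.
have fl h : H h -> f * h = 0.
  by move=> Hh; rewrite gE -mulrA zl //; exact: (idealMl iH).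
have fr h : H h -> h * f = 0.
  by move=> Hh; rewrite gE mulrA zr //; exact: (idealMr iH).
have [r|h Hh|N fN] := @nilpotent_central (f * f).
- apply/eqP; rewrite -subr_eq0.
  have -> : f * f * r - r * (f * f) = f * (f * r - r * f) + (f * r - r * f) * f.
    by rewrite mulrBr mulrBl !mulrA addrA subrK.
  by rewrite (fl _ (Hcomm f r)) (fr _ (Hcomm f r)) addr0.
- by rewrite -mulrA (fl h Hh) mulr0.
exists ((g * g) ^+ N).
  by apply: monic_exp; rewrite !monicMl ?mon_sub.
have evalX p n : (map_poly (intr : int -> R) (p ^+ n)).[z] = (map_poly intr p).[z] ^+ n.
  elim: n => [|n IHn]; first by rewrite !expr0 rmorph1 hornerC.
  by rewrite !exprS evalM IHn.
by rewrite evalX evalM -/f.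
Qed.

Let finite_nat : exists2 m, (0 < m)%N & m%:R = 0 :> R.
Proof.
have [|i [j [lt_ij cij]]] := finite_pred_pigeonhole (f := fun i => i%:R * c) heart_finite.
  by move=> n; exact: (idealMl iH).
have [r|h|N N0] := @nilpotent_central (j - i)%:R.
- exact/commr_sym/commr_nat.
- move: h; apply: heart_ind.
  + by rewrite natrB ?(ltnW lt_ij) // mulrBl cij subrr.
  + by rewrite mulr0.
  + by move=> a b _ _ za zb; rewrite mulrBr za zb subrr.
  + by move=> r a Ha za; rewrite commL // za mulr0.
  + by move=> r a _ za; rewrite mulrA za mul0r.
exists ((j - i) ^ N)%N; first by rewrite expn_gt0 subn_gt0 lt_ij.
by rewrite natrX.
Qed.

Let finite_int : finite_pred (fun r : R => exists z : int, r = z%:~R).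
Proof. by have [m m_gt0 m0] := finite_nat; exact: finite_intr m_gt0 m0. Qed.

(** The integers have a finite image and the monic equations of [x] and [y] bound the degrees, so
    [ev] has a finite range; every element is the sum of one in this range and one in the finite
    [H]. *)
Lemma square_zero_heart_finite : finite_pred (fun _ : R => True).
Proof.
have [qx mon_qx qx0] := integral_nilpotent x.
have [qy mon_qy qy0] := integral_nilpotent y.
have fin1 : finite_pred (fun r => exists p, r = ev1 p).
  pose d := (size qx).-1.
  have szq : size qx = d.+1 by rewrite /d prednK // lt0n size_poly_eq0 monic_neq0.
  apply: finite_pred_sub (@finite_pred_sum _ d (fun i v =>
    exists t u : R, [/\ exists z : int, t = z%:~R, u = x ^+ i & v = t * u]) _) _.
    move=> i _; apply: finite_pred_map2 => //.
    by exists [:: x ^+ i] => _ ->; rewrite inE.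
  move=> _ [p ->]; pose r := rmodp p qx.
  have szr : (size r <= d)%N by rewrite -ltnS -szq ltn_rmodp monic_neq0.
  have -> : ev1 p = ev1 r.
    by rewrite {1}(rdivp_eq mon_qx p) raddfD /= ev1M [ev1 qx]qx0 mulr0 add0r.
  exists (fun i => (r`_i)%:~R * x ^+ i).
    by move=> i _; exists (r`_i)%:~R, (x ^+ i); split=> //; exists r`_i.
  rewrite /ev1 (@horner_coef_wide _ d) ?(leq_trans (size_poly _ _)) //.
  by apply: eq_bigr => i _; rewrite coef_map.
pose Q : {poly {poly int}} := map_poly polyC qy.
have mon_Q : Q \is monic by rewrite monic_map.
(* Here [ev] is multiplicative exactly: the coefficients of [Q] are integers, so [x] and [y] are
   never exchanged. *)
have evQ P : ev (P * Q) = 0.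
  have QE : map_poly ev1 Q = map_poly intr qy.
    apply/polyP => i; rewrite /Q !coef_map /=.
    by rewrite /ev1 map_polyC hornerC.
  have -> : ev (P * Q) = ev P * (map_poly intr qy).[y].
    rewrite /ev -hornerM_comm; last exact: intr_comm.
    rewrite -QE; congr (_.[_]); apply/polyP => i.
    rewrite coef_map !coefM raddf_sum; apply: eq_bigr => j _.
    by rewrite !coef_map /= ev1M.
  by rewrite qy0 mulr0.
have fin2 : finite_pred (fun r => exists P, r = ev P).
  pose d := (size Q).-1.
  have szq : size Q = d.+1 by rewrite /d prednK // lt0n size_poly_eq0 monic_neq0.
  apply: finite_pred_sub (@finite_pred_sum _ d (fun i v =>
    exists t u : R, [/\ exists p, t = ev1 p, u = y ^+ i & v = t * u]) _) _.
    move=> i _; apply: finite_pred_map2 => //.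
    by exists [:: y ^+ i] => _ ->; rewrite inE.
  move=> _ [p ->]; pose r := rmodp p Q.
  have szr : (size r <= d)%N by rewrite -ltnS -szq ltn_rmodp monic_neq0.
  have -> : ev p = ev r.
    by rewrite {1}(rdivp_eq mon_Q p) evD evQ add0r.
  exists (fun i => ev1 r`_i * y ^+ i).
    by move=> i _; exists (ev1 r`_i), (y ^+ i); split=> //; exists r`_i.
  rewrite /ev (@horner_coef_wide _ d) ?(leq_trans (size_poly _ _)) //.
  by apply: eq_bigr => i _; rewrite coef_map.
apply: finite_pred_sub (finite_pred_map2 +%R fin2 heart_finite) _ => r _.
have [P rP] := ev_onto r; exists (ev P), (r - ev P); split=> //; first by exists P.
by rewrite addrC subrK.
Qed.

End SquareZeroHeart.

(** * From square-zero ideals to domains *)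

Section NoFiniteNoncommutative.
Variable S : identity_set.
Hypothesis finite_commutative : forall R : nzRingType,
  satisfies S R -> finite_pred (fun _ : R => True) -> commutative (@GRing.mul R).

(** Otherwise pass to a subdirectly irreducible subquotient [Q] of the generated subring. The image
    of [N] is an ideal containing the nonzero commutator, so it contains the heart, which therefore
    has square zero; then [Q] is finite, hence commutative. *)
Lemma square_zero_commute (R : nzRingType) (a b : R) (N : R -> Prop) :
    satisfies S R -> ideal_of (gen_subring a b) N ->
    (forall m n, N m -> N n -> m * n = 0) -> N (a * b - b * a) ->
  a * b = b * a.
Proof.
move=> satR iN NN Nab; apply: contrapT => /subdirectly_irreducible_subquotient.
move=> [Q [I [pi [qpi c0 Hc]]]]; pose G := gen_subring a b.
have sG : subring G := subring_gen a b.
have Ga : G a := @gen_subring_l _ a b; have Gb : G b := @gen_subring_r _ a b.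
have iN' : ideal (fun q => exists n, [/\ G n, N n & q = pi n]).
  split=> [|_ _ [m [Gm Nm ->]] [n [Gn Nn ->]]|q _ [n [Gn Nn ->]]|q _ [n [Gn Nn ->]]].
  - by exists 0; split; [exact: subring0|exact: ideal_of0 iN|rewrite (sq0 sG qpi)].
  - exists (m - n); split; [exact: (subringB sG)|exact: (ideal_ofB iN)|].
    by rewrite (sqB qpi).
  - have [r Gr <-] := sq_onto qpi q.
    exists (r * n); split; [exact: (subringM sG)| |by rewrite (sqM qpi)].
    exact: (ideal_ofMl iN) _ _ Gr Nn.
  - have [r Gr <-] := sq_onto qpi q.
    exists (n * r); split; [exact: (subringM sG)| |by rewrite (sqM qpi)].
    exact: (ideal_ofMr iN) _ _ Gr Nn.
have HN (h : Q) : in_heart h -> exists n, [/\ G n, N n & h = pi n].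
  move=> Hh; apply: (Hh _ iN' _ _ c0); exists (a * b - b * a); split.
  - by apply: (subringB sG); exact: (subringM sG).
  - exact: Nab.
  - by rewrite (sqB qpi) ?(sqM qpi) //; exact: (subringM sG).
have HH (h k : Q) : in_heart h -> in_heart k -> h * k = 0.
  move=> Hh Hk; have [m [Gm Nm ->]] := HN h Hh; have [n [Gn Nn ->]] := HN k Hk.
  by rewrite -(sqM qpi) // NN // (sq0 sG qpi).
have gQ := generated_subquotient qpi.
have finQ := square_zero_heart_finite gQ c0 Hc HH.
have satQ := satisfies_subquotient sG qpi satR.
by apply: c0; rewrite (finite_commutative satQ finQ) subrr.
Qed.

Section Prime.
Variables (R : nzRingType) (x y : R).
Hypothesis satR : satisfies S R.
Hypothesis gen : generated_by x y.
Let c := x * y - y * x.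
Hypotheses (c0 : c <> 0) (Hc : in_heart c).

Let ideal_kill_left b : ideal (fun h : R => forall r : R, h * r * b = 0).
Proof.
split=> [r|h k hb kb r|s h hb r|s h hb r].
- by rewrite !mul0r.
- by rewrite !mulrBl hb kb subrr.
- by rewrite -!mulrA; have := hb r; rewrite -!mulrA => ->; rewrite mulr0.
- by rewrite -(mulrA h) hb.
Qed.

Let ideal_kill_right a : ideal (fun h : R => forall r : R, a * r * h = 0).
Proof.
split=> [r|h k ha ka r|s h ha r|s h ha r].
- by rewrite mulr0.
- by rewrite mulrBr ha ka subrr.
- by rewrite mulrA -(mulrA a) ha.
- by rewrite mulrA ha mul0r.
Qed.

(** If [a R b = 0] with [a] and [b] nonzero, the two annihilator ideals above contain the heart in
    turn: [c R b = 0], then [c R c = 0], and finally the heart has square zero, which forces [x] and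
    [y] to commute. *)
Lemma heart_prime (a b : R) : a <> 0 -> (forall r, a * r * b = 0) -> b = 0.
Proof.
move=> a0 ab; apply: contrapT => b0.
have ca : forall r, c * r * b = 0 := Hc (ideal_kill_left b) ab a0.
have cc : forall r, c * r * c = 0 := Hc (ideal_kill_right c) ca b0.
have HH (h k : R) : in_heart h -> in_heart k -> h * k = 0.
  move=> Hh Hk; have hc r : h * r * c = 0 := Hh _ (ideal_kill_left c) _ cc c0 r.
  by have := Hk _ (ideal_kill_right h) _ hc c0 1; rewrite mulr1.
apply: c0; rewrite /c (square_zero_commute (N := @in_heart R) satR) ?subrr //.
have iH := ideal_heart R; split=> [r _||||].
- by move=> A sA Ax Ay; exact: (gen sA Ax Ay).
- exact: ideal0 iH.
- exact: idealB iH.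
- by move=> r h _; exact: idealMl iH r h.
- by move=> r h _; exact: idealMr iH r h.
Qed.

(** The subring generated by [a] and [t = a r] consists of sums of an integer and an element of
    [a R]. In it, the elements of [a R] that kill [a R] from the left form an ideal [N] of square
    zero containing [a t - t a = - a r a]. So [a r a = 0] for every [r], and primeness applies. *)
Lemma heart_reduced (a : R) : a * a = 0 -> a = 0.
Proof.
move=> aa; apply: contrapT => a0.
suff aRa r : a * r * a = 0 by exact: a0 (heart_prime a0 aRa).
pose t := a * r; pose G := gen_subring a t; have sG : subring G := subring_gen a t.
pose N u := [/\ G u, exists v, u = a * v & forall s, u * (a * s) = 0].
have GE g : G g -> exists (z : int) w, g = z%:~R + a * w.
  move=> Gg; apply: (Gg (fun g => exists (z : int) w, g = z%:~R + a * w)).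
  - split; first by exists 1, 0; rewrite mulr0 addr0.
      move=> _ _ [z [w ->]] [z' [w' ->]]; exists (z - z'), (w - w').
      by rewrite mulrBr rmorphB opprD addrACA.
    move=> _ _ [z [w ->]] [z' [w' ->]].
    exists (z * z'), (w * z'%:~R + z%:~R * w' + w * a * w').
    rewrite mulrDl !mulrDr rmorphM -!addrA; congr (_ + _).
    by rewrite !mulrA [a * z%:~R]commr_int addrCA.
  - by exists 0, 1; rewrite add0r mulr1.
  - by exists 0, r; rewrite add0r.
have at0 : a * t - t * a = - (a * r * a) by rewrite /t mulrA aa mul0r sub0r.
suff : a * t = t * a.
  by move/eqP; rewrite -subr_eq0 at0 oppr_eq0 => /eqP.
apply: (square_zero_commute (N := N) satR).
- split.
  + by move=> u [].
  + by split; [exact: subring0|exists 0; rewrite mulr0|move=> s; rewrite mul0r].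
  + move=> u v [Gu [u' uE] u0] [Gv [v' vE] v0]; split; first exact: (subringB sG).
      by exists (u' - v'); rewrite uE vE mulrBr.
    by move=> s; rewrite mulrBl u0 v0 subrr.
  + move=> g u Gg [Gu [v uE] u0]; split; first exact: (subringM sG).
      have [z [w ->]] := GE g Gg; exists (z%:~R * v + w * a * v).
      by rewrite uE mulrDl mulrDr !mulrA [a * z%:~R]commr_int.
    by move=> s; rewrite -mulrA u0 mulr0.
  + move=> g u Gg [Gu [v uE] u0].
    have ug : exists z : int, u * g = u * z%:~R.
      by have [z [w ->]] := GE g Gg; exists z; rewrite mulrDr u0 addr0.
    split; first exact: (subringM sG).
      by have [z ->] := ug; exists (v * z%:~R); rewrite uE mulrA.
    by move=> s; have [z ->] := ug; rewrite -mulrA -(commr_int (a * s) z) mulrA u0 mul0r.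
- by move=> m _ [_ _ m0] [_ [v ->] _]; exact: m0.
- rewrite at0; split.
  + rewrite -at0; apply: (subringB sG); apply: (subringM sG);
    by [exact: gen_subring_l|exact: gen_subring_r].
  + by exists (- (r * a)); rewrite mulrN mulrA.
  + by move=> s; rewrite mulNr !mulrA -(mulrA (a * r)) aa mulr0 mul0r oppr0.
Qed.

(** [(b a)^2 = 0] gives [b a = 0]; then [(a r b)^2 = 0], so [a r b = 0] for every [r], and primeness
    concludes. *)
Lemma heart_domain (a b : R) : a * b = 0 -> a = 0 \/ b = 0.
Proof.
move=> ab; have [->|a0] := pselect (a = 0); [by left|right].
apply: (heart_prime a0) => r; apply: heart_reduced.
have ba : b * a = 0 by apply: heart_reduced; rewrite mulrA -(mulrA b) ab mulr0 mul0r.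
by rewrite !mulrA -(mulrA (a * r)) ba mulr0 !mul0r.
Qed.

End Prime.
End NoFiniteNoncommutative.

(** * Infinite centers *)

Definition is_domain (R : nzRingType) : Prop :=
  forall a b : R, a * b = 0 -> a = 0 \/ b = 0.

Definition central (R : nzRingType) (z : R) : Prop := forall r, z * r = r * z.

Lemma horner_nceval (s : nat) (R : nzRingType) (r : 'I_s -> {poly R}) (P : ncpoly s)
    (z : R) :
  central z -> (nceval r P).[z] = nceval (fun i => (r i).[z]) P.
Proof.
move=> cz; have comz (p : {poly R}) : comm_poly p z by rewrite /comm_poly cz.
have horner_int (k : int) : (k%:~R : {poly R}).[z] = k%:~R.
  by rewrite -[k%:~R]/(intr k) -(rmorph_int polyC) hornerC.
rewrite /nceval !mmapE horner_sum; apply: eq_bigr => m _.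
rewrite hornerM_comm // horner_int; congr (_ * _); rewrite /word_eval.
elim: (fmonom_val m : seq _) => [|i w IHw]; first by rewrite !big_nil hornerC.
by rewrite !big_cons hornerM_comm // IHw.
Qed.

Lemma central_roots_bound (R : nzRingType) (p : {poly R}) (zs : seq R) :
    is_domain R -> p != 0 -> uniq zs ->
    (forall z, z \in zs -> central z /\ p.[z] = 0) ->
  (size zs < size p)%N.
Proof.
move=> dom; elim: zs p => [|z zs IHzs] p p0 /=; first by rewrite lt0n size_poly_eq0.
move=> /andP[zzs uzs] zsP.
have [cz /rootP/factor_theorem[q pE]] := zsP z (mem_head _ _).
have q0 : q != 0 by apply: contraNneq p0 => q0; rewrite pE q0 mul0r.
rewrite pE size_Mmonic ?monicXsubC // size_XsubC addn2 ltnS; apply: IHzs => // t tzs.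
have [|ct] := zsP t; first by rewrite inE tzs orbT.
rewrite pE hornerM_comm ?hornerXsubC => [/dom[//|/eqP]|].
  by rewrite subr_eq0 => /eqP tz; rewrite -tz tzs in zzs.
by rewrite /comm_poly ct.
Qed.

Lemma infinite_uniq (T : eqType) (A : T -> Prop) : ~ finite_pred A ->
  forall n, exists s : seq T, [/\ size s = n, uniq s & forall a, a \in s -> A a].
Proof.
move=> infA; elim=> [|n [s [ss us As]]]; first by exists [::].
have [a Aa /negP as_] : exists2 a, A a & ~ a \in s.
  apply: contrapT => no; apply: infA; exists s => a Aa; apply: contrapT => as_.
  by apply: no; exists a.
exists (a :: s) => /=; rewrite ss us as_; split=> // b; rewrite inE.
by move=> /predU1P[->//|/As].
Qed.

Section NoFiniteNoncommutative.
Variable S : identity_set.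
Hypothesis finite_commutative : forall R : nzRingType,
  satisfies S R -> finite_pred (fun _ : R => True) -> commutative (@GRing.mul R).

(** A value of an identity in [{poly R}] vanishes at every central element, which are too many roots
    for a nonzero polynomial over a domain. *)
Lemma satisfies_poly (R : nzRingType) :
    is_domain R -> satisfies S R -> ~ finite_pred (@central R) ->
  satisfies S {poly R}.
Proof.
move=> dom satR infZ s P SP r; apply/eqP; apply: contrapT => /negP q0.
have [zs [szs uzs zsP]] := infinite_uniq infZ (size (nceval r P)).
have : (size zs < size (nceval r P))%N.
  apply: central_roots_bound => // z /zsP cz.
  by split=> //; rewrite horner_nceval //; exact: satR.
by rewrite szs ltnn.
Qed.

(** In [Q = R[t]/(t^2)], which satisfies the identities, the ideal of [t] has square zero. It
    contains the commutator [(a b - b a) t] of [u = a] and [v = b t], so this commutator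
    vanishes. *)
Lemma infinite_center_commutative (R : nzRingType) :
    is_domain R -> satisfies S R -> ~ finite_pred (@central R) ->
  commutative (@GRing.mul R).
Proof.
move=> dom satR infZ a b; have satP := satisfies_poly dom satR infZ.
pose I (p : {poly R}) := p`_0 = 0 /\ p`_1 = 0.
have coef1M (p q : {poly R}) : (p * q)`_1 = p`_0 * q`_1 + p`_1 * q`_0.
  by rewrite coefM big_ord_recl big_ord1.
have coef0M' (p q : {poly R}) : (p * q)`_0 = p`_0 * q`_0.
  by rewrite coefM big_ord1.
have iI : ideal I.
  split=> [|p q [p0 p1] [q0 q1]|p q [q0 q1]|p q [q0 q1]]; rewrite /I.
  - by rewrite !coef0.
  - by rewrite !coefB p0 p1 q0 q1 subrr.
  - by rewrite coef1M coef0M' q0 q1 !mulr0 addr0.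
  - by rewrite coef1M coef0M' q0 q1 !mul0r addr0.
have sT := subringT {poly R}.
have [|Q [pi qpi]] := subquotient_exists sT (ideal_ofT iI).
  by case=> /eqP; rewrite coef1 oner_eq0.
have satQ := satisfies_subquotient sT qpi satP.
pose u := a%:P; pose v := b *: 'X.
pose N q := gen_subring (pi u) (pi v) q /\ exists2 p : {poly R}, p`_0 = 0 & q = pi p.
have sG := subring_gen (pi u) (pi v).
have gu := @gen_subring_l _ (pi u) (pi v); have gv := @gen_subring_r _ (pi u) (pi v).
have uv : pi u * pi v = pi v * pi u.
  apply: (square_zero_commute finite_commutative (N := N) satQ).
  - split.
    + by move=> q [].
    + by split; [exact: subring0|exists 0; rewrite ?coef0 ?(sq0 sT qpi)].
    + move=> t t' [Gt [p p0 tp]] [Gt' [q q0 tq]]; split; first exact: (subringB sG).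
      by exists (p - q); rewrite ?tp ?tq ?(sqB qpi) // coefB p0 q0 subrr.
    + move=> r t Gr [Gt [q q0 tq]]; split; first exact: (subringM sG).
      have [p _ <-] := sq_onto qpi r.
      by exists (p * q); rewrite ?tq ?(sqM qpi) // coef0M' q0 mulr0.
    + move=> r t Gr [Gt [q q0 tq]]; split; first exact: (subringM sG).
      have [p _ <-] := sq_onto qpi r.
      by exists (q * p); rewrite ?tq ?(sqM qpi) // coef0M' q0 mul0r.
  - move=> _ _ [_ [p p0 ->]] [_ [q q0 ->]]; rewrite -(sqM qpi) //.
    by apply/(sq_eq0 qpi) => //; rewrite /I coef0M' coef1M p0 q0 !mul0r mulr0 addr0.
  - split; first by apply: (subringB sG); exact: (subringM sG).
    exists (u * v - v * u); rewrite ?(sqB qpi) ?(sqM qpi) //.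
    by rewrite coefB !coef0M' !coefZ !coefX !mulr0 mul0r subrr.
have : I (u * v - v * u).
  by apply/(sq_eq0 qpi) => //; rewrite (sqB qpi) // !(sqM qpi) // uv subrr.
case=> _ /eqP; rewrite coefB !coef1M !coefC !coefZ !coefX /=.
by rewrite !(mulr0, mul0r, mulr1, addr0, add0r) subr_eq0 => /eqP.
Qed.

End NoFiniteNoncommutative.

(** * Multilinear identities *)

(** Integer noncommutative polynomials as lists of coefficients and words; a word may be listed
    several times, hence the sum in [word_coef]. *)
Definition word_poly := seq (int * seq nat).

Definition word_prod (R : nzRingType) (y : nat -> R) (w : seq nat) : R :=
  \prod_(i <- w) y i.

Definition word_sum (R : nzRingType) (W : word_poly) (y : nat -> R) : R :=
  \sum_(aw <- W) word_prod y aw.2 *~ aw.1.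

Definition word_coef (W : word_poly) (w : seq nat) : int :=
  \sum_(aw <- W | aw.2 == w) aw.1.

(* Setting the variable [t] to 0 removes exactly the words in which [t] occurs. *)
Lemma word_sum_filter (R : nzRingType) (W : word_poly) (ts : seq nat) :
  (forall y : nat -> R, word_sum W y = 0) ->
  forall y : nat -> R,
    word_sum [seq aw <- W | all (fun t => t \in aw.2) ts] y = 0.
Proof.
elim: ts W => [|t ts IHts] W W0 y.
  by rewrite (eq_filter (a2 := predT)) // filter_predT.
have Wt (z : nat -> R) : word_sum [seq aw <- W | t \in aw.2] z = 0.
  pose z' i := if i == t then 0 else z i.
  have zero w : t \in w -> word_prod z' w = 0.
    elim: w => //= i w IHw; rewrite inE /word_prod big_cons => /predU1P[<-|/IHw tw].
      by rewrite /z' eqxx mul0r.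
    by rewrite [\prod_(j <- w) _]tw mulr0.
  have same w : t \notin w -> word_prod z' w = word_prod z w.
    move=> tw; apply: eq_big_seq => i iw; rewrite /z'.
    by case: eqP => // it; rewrite -it iw in tw.
  have split_sum (u : nat -> R) : word_sum W u = word_sum [seq aw <- W | t \in aw.2] u +
      word_sum [seq aw <- W | t \notin aw.2] u.
    by rewrite /word_sum !big_filter [LHS](bigID (fun aw => t \in aw.2)).
  have := W0 z; rewrite split_sum.
  have -> : word_sum [seq aw <- W | t \notin aw.2] z = word_sum W z'.
    rewrite split_sum [X in _ = X + _]big_filter big1 ?add0r => [|aw tw].
      by rewrite /word_sum !big_filter; apply: eq_bigr => aw /same ->.
    by rewrite zero // mul0rz.
  by rewrite W0 addr0.
rewrite (eq_filter (a2 := fun aw => all (fun t => t \in aw.2) ts && (t \in aw.2))).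
  by rewrite filter_predI IHts.
by move=> aw /=; rewrite andbC.
Qed.

Lemma word_prod_subst (R : nzRingType) (y : nat -> R) (j : nat) (t : R) (w : seq nat) :
    uniq w -> j \in w ->
  word_prod (fun i => if i == j then t else y i) w =
    word_prod y (take (index j w) w) * t * word_prod y (drop (index j w).+1 w).
Proof.
move=> uw jw; set w1 := take _ _; set w2 := drop _ _.
have wE : w = w1 ++ j :: w2.
  by rewrite -{1}(cat_take_drop (index j w) w) (drop_nth 0%N) ?index_mem ?nth_index.
have : uniq (w1 ++ j :: w2) by rewrite -wE.
rewrite cat_uniq /= negb_or => /and3P[_ /andP[jw1 _] /andP[jw2 _]].
rewrite wE /word_prod big_cat big_cons /= eqxx mulrA.
by congr (_ * _ * _); apply: eq_big_seq => i; case: eqP => // ->; rewrite ?(negPf jw1) ?(negPf jw2).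
Qed.

Section Multilinearization.
Variables (s : nat) (P : ncpoly s) (p : nat).
Let Ls : seq {fmonom 'I_s} := [seq m <- finmap.enum_fset (msupp P) | ~~ (p %| P@_m)%Z].

Section TopMonomial.
Variable m0 : {fmonom 'I_s}.
Hypotheses (m0L : m0 \in Ls) (m0max : forall m : {fmonom 'I_s}, m \in Ls ->
  (size (m : seq 'I_s) <= size (m0 : seq 'I_s))%N).
Let d := size (m0 : seq 'I_s).

(** Each position [t] of [m0] gets its own variable, and [X_i] is replaced by the sum of the
    variables at the positions of the letter [i]; [expand m] lists the words this produces from
    [m]. *)
Let letters (i : 'I_s) : seq nat := [seq t <- iota 0 d | onth (m0 : seq 'I_s) t == Some i].

Fixpoint expand (m : seq 'I_s) : seq (seq nat) :=
  if m is i :: m' then [seq t :: w | t <- letters i, w <- expand m'] else [:: [::]].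

Let expand_uniq m : uniq (expand m).
Proof.
elim: m => //= i m IHm; apply: allpairs_uniq => //.
  by rewrite filter_uniq // iota_uniq.
by move=> [t w] [t' w'] _ _ /= [-> ->].
Qed.

Let size_expand m w : w \in expand m -> size w = size m.
Proof.
elim: m w => [|i m IHm] w /=; first by rewrite inE => /eqP ->.
by move=> /allpairsP[[t w'] /= [_ /IHm <- ->]].
Qed.

Let expand_map m w : w \in expand m -> map (onth (m0 : seq 'I_s)) w = map Some m.
Proof.
elim: m w => [|i m IHm] w /=; first by rewrite inE => /eqP ->.
move=> /allpairsP[[t w'] /= [+ /IHm <- ->]] /=.
by rewrite mem_filter => /andP[/eqP ->].
Qed.

Let expand_mem m w : all (fun t => t < d)%N w ->
  map (onth (m0 : seq 'I_s)) w = map Some m -> w \in expand m.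
Proof.
elim: m w => [|i m IHm] [|t w] //= /andP[lt_td dw] [ti wm].
by apply/allpairsP; exists (t, w); rewrite /= mem_filter ti eqxx mem_iota IHm.
Qed.

Let map_onth_iota : map (onth (m0 : seq 'I_s)) (iota 0 d) = map Some m0.
Proof.
apply: (@eq_from_nth _ None); first by rewrite !size_map size_iota.
move=> i; rewrite size_map size_iota => lt_id.
by rewrite (nth_map 0%N) ?size_iota // nth_iota // onthE.
Qed.

Let iota_expand (m : {fmonom 'I_s}) : (iota 0 d \in expand m) = (m == m0).
Proof.
apply/idP/eqP => [/expand_map|->].
  rewrite map_onth_iota => /esym /inj_map mE; apply: val_inj; apply: mE.
  by move=> i j [].
by apply: expand_mem map_onth_iota; apply/allP => t; rewrite mem_iota.
Qed.

Let word_eval_expand (R : nzRingType) (y : nat -> R) (m : seq 'I_s) :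
  \prod_(i <- m) (\sum_(t <- letters i) y t) = \sum_(w <- expand m) word_prod y w.
Proof.
elim: m => [|i m IHm] /=; first by rewrite big_nil big_seq1 /word_prod big_nil.
rewrite big_cons IHm big_allpairs_dep mulr_suml; apply: eq_bigr => t _.
by rewrite mulr_sumr; apply: eq_bigr => w _; rewrite /word_prod big_cons.
Qed.

Let W0 : word_poly := [seq (P@_m, w) | m <- Ls, w <- expand (m : seq 'I_s)].
Let W : word_poly := [seq aw <- W0 | all (fun t => t \in aw.2) (iota 0 d)].

(** A word with all [d] variables has length at least [d], and at most [d] by the maximality of
    [m0], so each variable occurs exactly once. *)
Let W_perm aw : aw \in W -> perm_eq aw.2 (iota 0 d).
Proof.
rewrite mem_filter => /andP[/allP dw /allpairsPdep[m [w [mL wm awE]]]].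
rewrite awE /= in dw *.
have szw : (size w <= size (iota 0 d))%N by rewrite size_iota (size_expand wm) m0max.
have uw : uniq w by apply: leq_size_uniq szw; [exact: iota_uniq|exact: dw].
rewrite perm_sym; apply: uniq_perm => //; first exact: iota_uniq.
by have [_] := uniq_min_size (iota_uniq 0 d) dw szw.
Qed.

Let W_coef : word_coef W (iota 0 d) = P@_m0.
Proof.
rewrite /word_coef big_filter_cond.
rewrite (eq_bigl (fun aw : int * seq nat => aw.2 == iota 0 d)); last first.
  by move=> aw; case: eqP => [->|//]; rewrite ?andbF // andbT; apply/allP.
rewrite big_mkcond big_allpairs_dep /=.
rewrite (bigD1_seq m0) ?filter_uniq ?finmap.fset_uniq //= addrC big1_seq ?add0r; last first.
  move=> m /andP[mm0 _]; rewrite big1_seq // => w /= wm.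
  by case: eqP => // wE; rewrite wE iota_expand (negPf mm0) in wm.
rewrite (bigD1_seq (iota 0 d)) ?iota_expand //= eqxx big1 ?addr0 // => w.
by move=> /negPf ->.
Qed.

Let W_sum (R : nzRingType) (y : nat -> R) :
  p%:R = 0 :> R -> is_identity P R -> word_sum W y = 0.
Proof.
move=> p0 PR; apply: word_sum_filter => {}y.
rewrite -(PR (fun i => \sum_(t <- letters i) y t)) /nceval mmapE.
rewrite (bigID (fun m => p %| P@_m)%Z) /= big1 ?add0r => [|m /dvdzP[q ->]]; last first.
  by rewrite intrM -[p%:~R]/(p%:R) p0 mulr0 mul0r.
rewrite /word_sum big_allpairs_dep /= big_filter; apply: eq_bigr => m _.
rewrite /word_eval word_eval_expand mulrzl mulrz_suml.
by apply: eq_bigr.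
Qed.

(** After the substitution only the words containing every variable are kept. The word [0, ..., d-1]
    arises from [m0] alone, as reading the letters of [m0] along a word recovers its monomial, so it
    keeps the coefficient of [m0]. *)
Lemma multilinearize_top : exists d W, [/\ forall aw, aw \in W -> perm_eq aw.2 (iota 0 d),
   ~~ (p %| word_coef W (iota 0 d))%Z &
   forall (R : nzRingType) (y : nat -> R), p%:R = 0 :> R -> is_identity P R ->
     word_sum W y = 0].
Proof.
exists d, W; split; [exact: W_perm| |by move=> R y; exact: W_sum].
by rewrite W_coef; move: m0L; rewrite mem_filter => /andP[].
Qed.

End TopMonomial.

Lemma multilinearize (m1 : {fmonom 'I_s}) : ~~ (p %| P@_m1)%Z ->
  exists d W, [/\ forall aw, aw \in W -> perm_eq aw.2 (iota 0 d),
   ~~ (p %| word_coef W (iota 0 d))%Z &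
   forall (R : nzRingType) (y : nat -> R), p%:R = 0 :> R -> is_identity P R ->
     word_sum W y = 0].
Proof.
move=> pm1.
have m1L : m1 \in Ls.
  rewrite mem_filter pm1 /= -mcoeff_neq0.
  by apply: contraNneq pm1 => ->; rewrite dvdz0.
pose Q n := `[< forall m : {fmonom 'I_s}, m \in Ls -> (size (m : seq 'I_s) <= n)%N >].
have exQ : exists n, Q n.
  exists (\max_(m <- Ls) size (m : seq 'I_s)); apply/asboolP => m mL.
  exact: (@leq_bigmax_seq _ Ls predT (fun m : {fmonom 'I_s} => size (m : seq 'I_s))).
case: (ex_minnP exQ) => n /asboolP nP min_n.
have [m0 m0L szm0] : exists2 m0 : {fmonom 'I_s}, m0 \in Ls & size (m0 : seq 'I_s) = n.
  apply: contrapT => no; case: n => [|n] in nP min_n no.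
    by apply: no; exists m1 => //; apply/eqP; rewrite -leqn0 nP.
  have /min_n : Q n; last by rewrite ltnn.
  apply/asboolP => m mL; have := nP m mL; rewrite leq_eqVlt => /predU1P[sz|//].
  by exfalso; apply: no; exists m.
by apply: (multilinearize_top m0L) => m /nP; rewrite szm0.
Qed.

End Multilinearization.

(** * Division rings *)

Definition is_division (R : nzRingType) : Prop :=
  forall a : R, a <> 0 -> exists b, b * a = 1 /\ a * b = 1.

Lemma intr_eq0_dvd (R : nzRingType) (p : nat) (z : int) :
  prime p -> p%:R = 0 :> R -> z%:~R = 0 :> R -> (p %| z)%Z.
Proof.
move=> p_prime p0 z0; apply: contrapT => /negP pz.
have : coprimez p z by rewrite /coprimez /gcdz eqz_nat -[_ == _]/(coprime _ _) prime_coprime.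
move=> /coprimezP[[k l] /= kl].
have : (1 : int)%:~R = 0 :> R.
  by rewrite -kl rmorphD !rmorphM /= z0 -[p%:~R]/(p%:R) p0 !mulr0 addr0.
by move/eqP; rewrite oner_eq0.
Qed.

Section DivisionHeart.
Variables (R : nzRingType) (c : R).
Hypotheses (dom : is_domain R) (c0 : c <> 0) (Hc : in_heart c).

Let dom_neq0 (a b : R) : a <> 0 -> b <> 0 -> a * b <> 0.
Proof. by move=> a0 b0 /dom[]. Qed.

(* In a shortest relation each coefficient is determined by the leading one, so
   that the coefficients are proportional to it by elements [z j] of the extended
   centroid. *)
Lemma heart_left_inverse (b : R) (u : nat -> R) (s : seq nat) (g0 : R) (g : nat -> R) :
    uniq s -> (forall j, j \in s -> exists2 h, in_heart h & u j = h * b) ->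
    g0 <> 0 -> (forall r, r * g0 + \sum_(j <- s) u j * r * g j = 0) ->
  exists v, v * b = 1.
Proof.
elim: {s}(size s) {-2}s (erefl (size s)) g0 g => [|n IHn] s szs g0 g us uH g00 gN.
  move/eqP: szs; rewrite size_eq0 => /eqP s0; move: (gN 1).
  by rewrite s0 big_nil addr0 mul1r.
(* [N] is the bimodule of relations with the same [u j]; a pair holds the leading coefficient and
   the other ones. *)
pose N (t : R * (nat -> R)) := forall r, r * t.1 + \sum_(j <- s) u j * r * t.2 j = 0.
have NB t t' : N t -> N t' -> N (t.1 - t'.1, fun j => t.2 j - t'.2 j).
  move=> Nt Nt' r /=; rewrite mulrBr.
  rewrite (eq_bigr (fun j => u j * r * t.2 j - u j * r * t'.2 j)) => [|j _].
    by rewrite sumrB addrACA -opprD Nt Nt' subrr.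
  by rewrite mulrBr.
have Nl a t : N t -> N (a * t.1, fun j => a * t.2 j).
  move=> Nt r /=; rewrite mulrA -[RHS](Nt (r * a)); congr (_ + _).
  by apply: eq_bigr => j _; rewrite !mulrA.
have Nr a t : N t -> N (t.1 * a, fun j => t.2 j * a).
  move=> Nt r; have := congr1 ( *%R^~ a) (Nt r); rewrite /= mul0r mulrDl mulr_suml => E.
  rewrite -[RHS]E mulrA; congr (_ + _); by apply: eq_bigr => j _; rewrite !mulrA.
have N0 : N (0, fun _ => 0).
  by move=> r; rewrite mulr0 add0r big1 // => j _; rewrite mulr0.
have Ng : N (g0, g) by [].
have [[t [j [Nt t0 js tj]]]|no] :=
    pselect (exists t j, [/\ N t, t.1 = 0, j \in s & t.2 j <> 0]).
  (* The [j]-th coefficients of relations with zero leading coefficient form a nonzero ideal, which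
     contains [g j * c]. Subtracting such a relation from [g] times [c] removes the term [j] and
     keeps the leading coefficient [g0 * c]. *)
  have iJ : ideal (fun z => exists t, [/\ N t, t.1 = 0 & z = t.2 j]).
    split=> [|_ _ [t1 [N1 z1 ->]] [t2 [N2 z2 ->]]|a _ [t1 [N1 z1 ->]]|a _ [t1 [N1 z1 ->]]].
    - by exists (0, fun _ => 0).
    - by exists (t1.1 - t2.1, fun j => t1.2 j - t2.2 j); split=> //=; [exact: NB|rewrite z1 z2 subrr].
    - by exists (a * t1.1, fun j => a * t1.2 j); split=> //=; [exact: Nl|rewrite z1 mulr0].
    - by exists (t1.1 * a, fun j => t1.2 j * a); split=> //=; [exact: Nr|rewrite z1 mul0r].
  have [t' [Nt' t'0 t'j]] : exists t', [/\ N t', t'.1 = 0 & g j * c = t'.2 j].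
    apply: (idealMl iJ); apply: (Hc iJ _ tj).
    by exists t.
  have Nd := NB _ _ (Nr c _ Ng) Nt'.
  apply: (IHn (rem j s) _ (g0 * c) (fun i => g i * c - t'.2 i)).
  - by rewrite size_rem // szs.
  - exact: rem_uniq.
  - by move=> i /mem_rem; exact: uH.
  - exact: dom_neq0.
  - move=> r; have := Nd r; rewrite /= t'0 subr0 (big_rem j) //= t'j subrr.
    by rewrite mulr0 add0r.
have proj0 t j : N t -> t.1 = 0 -> j \in s -> t.2 j = 0.
  by move=> Nt t0 js; apply: contrapT => tj; apply: no; exists t, j.
have iJ : ideal (fun z => exists2 t, N t & z = t.1).
  split=> [|_ _ [t1 N1 ->] [t2 N2 ->]|a _ [t1 N1 ->]|a _ [t1 N1 ->]].
  - by exists (0, fun _ => 0).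
  - by exists (t1.1 - t2.1, fun j => t1.2 j - t2.2 j) => //; exact: NB.
  - by exists (a * t1.1, fun j => a * t1.2 j) => //; exact: Nl.
  - by exists (t1.1 * a, fun j => t1.2 j * a) => //; exact: Nr.
(* For a relation [t] with leading coefficient [h], the relation [h b y g - t b y g0] has leading
   coefficient 0, so its [j]-th coefficient vanishes; thus [z] is [t.2 j]. *)
have uE j : exists z, j \in s -> forall y, u j * y * g j = z * b * y * g0.
  have [js|js] := boolP (j \in s); last by exists 0.
  have [h Hh ->] := uH j js.
  have [t Nt ht] : exists2 t, N t & h = t.1 by apply: (Hh _ iJ g0) => //; exists (g0, g).
  exists (t.2 j) => _ y; rewrite -(mulrA h) -(mulrA (t.2 j)).
  have := NB _ _ (Nl (h * (b * y)) _ Ng) (Nr ((b * y) * g0) _ Nt).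
  move=> /proj0 /= /(_ j); rewrite -ht !mulrA subrr => /(_ erefl js) /eqP.
  by rewrite subr_eq0 => /eqP.
have [z zE] := choice uE.
exists (- \sum_(j <- s) z j); apply/eqP; rewrite mulNr eq_sym -subr_eq0 opprK; apply/eqP.
have [|//|/g00 []//] := dom (a := 1 + (\sum_(j <- s) z j) * b) (b := g0).
rewrite -[RHS](gN 1) mulrDl; congr (_ + _); rewrite !mulr_suml.
by apply: eq_big_seq => j js; rewrite zE // mulr1.
Qed.

Variable p : nat.
Hypotheses (p_prime : prime p) (p0 : p%:R = 0 :> R).

Variable b : R.
Hypothesis b0 : b <> 0.
(** Values are restricted to this left ideal so that every nonempty word takes the form [h * b]
    required of the [u j]. *)
Let L v := exists2 h : R, in_heart h & v = h * b.

Let LM r v : L v -> L (r * v).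
Proof.
by move=> [h Hh ->]; exists (r * h); [exact: (idealMl (ideal_heart R))|rewrite mulrA].
Qed.

Let L_word (y : nat -> R) w : (forall i, L (y i)) -> w != [::] -> L (word_prod y w).
Proof.
move=> yL; case/lastP: w => // w i _; rewrite /word_prod -cats1 big_cat big_seq1.
exact: LM.
Qed.

(** Induction on the number of variables. Let [j] begin [w0], and let [Wj] collect the words
    beginning with [j], that letter removed. If [Wj] vanishes on [L], induction applies. Otherwise
    substituting [r c b] for [j] gives a relation with leading coefficient [c b g <> 0], the other
    words having a nonempty prefix before [j]. *)
Lemma identity_left_inverse (W : word_poly) (vars w0 : seq nat) :
    uniq vars -> (forall aw, aw \in W -> perm_eq aw.2 vars) ->
    ~~ (p %| word_coef W w0)%Z ->
    (forall y : nat -> R, (forall i, L (y i)) -> word_sum W y = 0) ->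
  exists v, v * b = 1.
Proof.
elim: {vars}(size vars) {-2}vars (erefl (size vars)) W w0 => [|n IHn] vars szv W w0 uv
  Wvars W0 Wsum.
  exfalso; move/negP: W0; apply; apply: (intr_eq0_dvd p_prime p0).
  have L0 : L 0 by exists 0; [exact: ideal0 (ideal_heart R)|rewrite mul0r].
  move/eqP: szv; rewrite size_eq0 => /eqP vars0.
  have Wnil aw : aw \in W -> aw.2 = [::].
    by move=> /Wvars; rewrite vars0 => /perm_nilP.
  have := Wsum (fun _ => 0) (fun _ => L0); rewrite /word_sum /word_coef.
  rewrite rmorph_sum big_seq (eq_bigr (fun aw : int * seq nat => aw.1%:~R)) => [|aw /Wnil ->].
    case: w0 => [|i w0] s0.
      by rewrite -[RHS]s0 [LHS]big_seq_cond; apply: eq_bigl => aw; case: (boolP (aw \in W)) => // /Wnil ->.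
    by rewrite big_seq_cond big1 // => aw /andP[/Wnil ->].
  by rewrite /word_prod big_nil.
have /hasP[aw0 aw0W /eqP aw0E] : has (fun aw => aw.2 == w0) W.
  apply: contraNT W0 => /hasPn noW; rewrite /word_coef big_seq_cond big1 ?dvdz0 //.
  by move=> aw /andP[/noW /negPf ->].
have pw0 : perm_eq w0 vars by rewrite -aw0E Wvars.
case: w0 => [|j w0] in W0 aw0E pw0 *.
  by move: (perm_size pw0); rewrite szv.
have jv : j \in vars by rewrite -(perm_mem pw0) mem_head.
pose Wj : word_poly := [seq (aw.1, behead aw.2) | aw <- W & ohead aw.2 == Some j].
have WjP aw : aw \in Wj -> perm_eq aw.2 (rem j vars).
  move=> /mapP[[a w]]; rewrite mem_filter /= => /andP[+ awW] ->; have := Wvars _ awW.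
  case: w {awW} => [|i w] //= pw /eqP[ij]; rewrite ij in pw.
  by rewrite -(perm_cons j) (perm_trans pw) // perm_to_rem.
have Wj0 : word_coef Wj w0 = word_coef W (j :: w0).
  rewrite /word_coef big_map big_filter_cond; apply: eq_bigl => -[a [|i w]] //=.
have [Wj_sum|] := pselect (forall y : nat -> R, (forall i, L (y i)) -> word_sum Wj y = 0).
  by apply: (IHn (rem j vars) _ Wj w0) => //; rewrite ?size_rem ?szv ?rem_uniq // Wj0.
move=> /existsNP[y /not_implyP[yL g0]]; set g := word_sum Wj y in g0.
pose W' : word_poly := [seq aw <- W | ohead aw.2 != Some j].
pose pre (aw : int * seq nat) := take (index j aw.2) aw.2.
pose post (aw : int * seq nat) := drop (index j aw.2).+1 aw.2.
have word_split aw t : aw \in W -> word_prod (fun i => if i == j then t else y i) aw.2 =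
    word_prod y (pre aw) * t * word_prod y (post aw).
  move=> awW; have pw := Wvars _ awW.
  by rewrite word_prod_subst // ?(perm_mem pw) // (perm_uniq pw).
have rel r : r * (c * b * g) + \sum_(0 <= k < size W')
    word_prod y (pre (nth (0, [::]) W' k)) * r *
    (c * b * (word_prod y (post (nth (0, [::]) W' k)) *~ (nth (0, [::]) W' k).1)) = 0.
  pose t := r * (c * b).
  have tL : L t by apply: LM; exists c.
  have y'L i : L (if i == j then t else y i) by case: (i == j).
  have := Wsum (fun i => if i == j then t else y i) y'L.
  rewrite /word_sum (bigID (fun aw => ohead aw.2 == Some j)) /= => E.
  rewrite -[RHS]E; congr (_ + _).
    rewrite !mulrA -[r * c * b]mulrA -/t /g /word_sum big_map big_filter mulr_sumr.
    rewrite big_seq_cond [RHS]big_seq_cond; apply: eq_bigr => -[a [|i w]] //=.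
      by rewrite andbF.
    move=> /andP[awW /eqP[ij]]; rewrite (word_split (a, i :: w) t awW) /pre /post /= ij eqxx /= drop0 ?take0.
    have -> : word_prod y [::] = 1 by rewrite /word_prod big_nil.
    by rewrite mul1r mulrzAr.
  rewrite -(big_nth (0, [::]) predT (fun aw : int * seq nat =>
    word_prod y (pre aw) * r * (c * b * (word_prod y (post aw) *~ aw.1)))) big_filter.
  rewrite big_seq_cond [RHS]big_seq_cond; apply: eq_bigr => aw /andP[awW _].
  by rewrite word_split // /t !mulrzAr !mulrA.
apply: (heart_left_inverse _ _ _ rel); first exact: iota_uniq.
  move=> k; rewrite mem_index_iota /= => lt_k; apply: L_word => //.
  have := mem_nth (0, [::]) lt_k; rewrite mem_filter => /andP[+ awW].
  have := Wvars _ awW; case: (nth _ _ _) => a [|i w] pw /=.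
    by move: (perm_mem pw j); rewrite jv.
  by rewrite /pre /= => ij; case: (i =P j) ij => [->|//]; rewrite eqxx.
by apply: dom_neq0 => //; exact: dom_neq0.
Qed.

End DivisionHeart.

Lemma heart_division (R : nzRingType) (c : R) (p : nat) (W : word_poly)
    (vars w0 : seq nat) :
    is_domain R -> c <> 0 -> in_heart c -> prime p -> p%:R = 0 :> R ->
    uniq vars -> (forall aw, aw \in W -> perm_eq aw.2 vars) ->
    ~~ (p %| word_coef W w0)%Z -> (forall y : nat -> R, word_sum W y = 0) ->
  is_division R.
Proof.
move=> dom c0 Hc pp p0 uv Wv W0 Wsum.
have linv (b : R) : b <> 0 -> exists v, v * b = 1.
  by move=> b0; apply: (identity_left_inverse dom c0 Hc pp p0 b0 uv Wv W0) => y _; exact: Wsum.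
move=> b b0; have [v vb] := linv b b0; exists v; split=> //.
have : (b * v - 1) * b = 0 by rewrite mulrBl mul1r -mulrA vb mulr1 subrr.
by move=> /dom[/eqP|//]; rewrite subr_eq0 => /eqP.
Qed.

(** A multilinear sum is additive in each variable and lets the central ['X] pass, so constant
    values suffice. Induction is on the list [ts] of variables allowed nonconstant values. *)
Lemma word_sum_poly (R : nzRingType) (W : word_poly) (vars : seq nat) :
    uniq vars -> (forall aw, aw \in W -> perm_eq aw.2 vars) ->
    (forall y : nat -> R, word_sum W y = 0) ->
  forall y : nat -> {poly R}, word_sum W y = 0.
Proof.
move=> uv Wv W0.
suff const (ts : seq nat) : {subset ts <= vars} -> forall y : nat -> {poly R},
    (forall i, i \notin ts -> exists c, y i = c%:P) -> word_sum W y = 0.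
  move=> y; pose y' i := if i \in vars then y i else 0.
  rewrite -(const vars _ y') // => [|i iv]; last by exists 0; rewrite /y' (negPf iv).
  apply: eq_big_seq => aw awW; congr (_ *~ _); apply: eq_big_seq => i.
  by rewrite (perm_mem (Wv _ awW)) /y' => ->.
elim: ts => [|t ts IHts] tsv y yc.
  have [c cE] := choice (fun i => yc i isT).
  rewrite -(rmorph0 polyC) -(W0 c) rmorph_sum; apply: eq_bigr => aw _.
  by rewrite rmorphMz /word_prod rmorph_prod; congr (_ *~ _); apply: eq_bigr.
have tv : t \in vars by rewrite tsv ?mem_head.
pose F q := word_sum W (fun i => if i == t then q else y i).
have Fsub aw q : aw \in W -> word_prod (fun i => if i == t then q else y i) aw.2 =
    word_prod y (take (index t aw.2) aw.2) * q *
    word_prod y (drop (index t aw.2).+1 aw.2).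
  move=> awW; rewrite word_prod_subst ?(perm_uniq (Wv _ awW)) //.
  by rewrite (perm_mem (Wv _ awW)).
have FD q r : F (q + r) = F q + F r.
  rewrite /F /word_sum -big_split /=; apply: eq_big_seq => aw awW.
  by rewrite !Fsub // mulrDr mulrDl mulrzDl.
have FX q : F (q * 'X) = F q * 'X.
  rewrite /F /word_sum mulr_suml; apply: eq_big_seq => aw awW.
  by rewrite !Fsub // mulrzAl; congr (_ *~ _); rewrite -!mulrA commr_polyX.
have FC c : F c%:P = 0.
  apply: IHts => [i its|i its]; first by apply: tsv; rewrite inE its orbT.
  by case: (i =P t) => it; [exists c|apply: yc; rewrite inE (introF eqP it)].
have F0 q : F q = 0.
  elim/poly_ind: q => [|q c IHq]; first by rewrite -polyC0 FC.
  by rewrite FD FX IHq mul0r add0r FC.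
rewrite -(F0 (y t)); apply: eq_big_seq => aw _; congr (_ *~ _).
by apply: eq_bigr => i _; case: eqP => // ->.
Qed.

(** Coefficients stand to the left of the powers of [x], so the right factor can be evaluated first;
    this makes [pact] an action. *)
Lemma horner_mul (R : nzRingType) (p q : {poly R}) (x : R) :
  (p * q).[x] = (p * (q.[x])%:P).[x].
Proof.
elim/poly_ind: p => [|p c IHp]; first by rewrite !mul0r.
rewrite !mulrDl -!mulrA -!commr_polyX !mulrA !hornerD !hornerMX IHp.
by rewrite !mul_polyC !hornerZ hornerC.
Qed.

(** * Algebraicity over the center, by density *)

Section Kaplansky.
Variables (D : nzRingType).
Hypothesis divD : is_division D.

Lemma division_domain : is_domain D.
Proof.
move=> a b ab; have [->|a0] := pselect (a = 0); [by left|right].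
by have [v [va _]] := divD a0; rewrite -[b]mul1r -va -mulrA ab mulr0.
Qed.

Variable x : D.

(* [s.v = \sum_j s_j v x^j]: the variable of [{poly D}] acts as right
   multiplication by [x]. *)
Definition pact (s : {poly D}) (v : D) : D := (s * v%:P).[x].

Lemma pactM s t v : pact (s * t) v = pact s (pact t v).
Proof. by rewrite /pact -mulrA horner_mul. Qed.

Lemma pactDr s u v : pact s (u + v) = pact s u + pact s v.
Proof. by rewrite /pact polyCD mulrDr hornerD. Qed.

Lemma pactBl s t v : pact (s - t) v = pact s v - pact t v.
Proof. by rewrite /pact mulrBl hornerD hornerN. Qed.

Lemma pactC a v : pact a%:P v = a * v.
Proof. by rewrite /pact -polyCM hornerC. Qed.

Lemma pactXl s v : pact ('X * s) v = pact s v * x.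
Proof. by rewrite -commr_polyX /pact -mulrA -commr_polyX mulrA hornerMX. Qed.

Lemma pactMr s v k : k * x = x * k -> pact s (v * k) = pact s v * k.
Proof.
move=> kx; rewrite /pact polyCM mulrA hornerM_comm ?hornerC //.
by rewrite /comm_poly hornerC kx.
Qed.

Lemma pact0 s : pact s 0 = 0. Proof. by rewrite /pact mulr0 horner0. Qed.

Lemma pactBr s u v : pact s (u - v) = pact s u - pact s v.
Proof.
by apply: (addIr (pact s v)); rewrite -pactDr !subrK.
Qed.

Lemma pact_sumr s J (r : seq J) (F : J -> D) :
  pact s (\sum_(j <- r) F j) = \sum_(j <- r) pact s (F j).
Proof.
by elim: r => [|j r IHr]; rewrite ?big_nil ?pact0 // !big_cons pactDr IHr.
Qed.

Lemma pact_suml v J (r : seq J) (F : J -> {poly D}) :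
  pact (\sum_(j <- r) F j) v = \sum_(j <- r) pact (F j) v.
Proof. by rewrite /pact mulr_suml horner_sum. Qed.

Let cent (k : nat -> D) := forall i, k i * x = x * k i.

(** The coefficients, on the right, lie in the centralizer of [x]; their right multiplications
    commute with [pact]. *)
Definition cspan (js : seq nat) (v : nat -> D) (t : D) : Prop :=
  exists2 k, cent k & t = \sum_(j <- js) v j * k j.

Definition cfree (js : seq nat) (v : nat -> D) : Prop :=
  forall k, cent k -> \sum_(j <- js) v j * k j = 0 -> forall j, j \in js -> k j = 0.

(** Jacobson density for [pact], by induction on [js]. Suppose every [s] killing the family kills
    [t]. If [v j] is outside the span of [js], some [s1] kills [js] and sends [v j] to 1; then
    [k0 = pact s1 t] centralizes [x], and [t - v j k0] is in the span of [js] by induction. *)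
Lemma density (js : seq nat) (v : nat -> D) (t : D) : uniq js -> ~ cspan js v t ->
  exists s, (forall j, j \in js -> pact s (v j) = 0) /\ pact s t <> 0.
Proof.
elim: js t => [|j js IHjs] t /=.
  move=> _ nt; exists 1; split=> //; rewrite -polyC1 pactC mul1r => t0.
  by apply: nt; exists (fun _ => 0) => [i|]; rewrite ?mul0r ?mulr0 // big_nil.
move=> /andP[jjs ujs] nt; apply: contrapT => no.
have kill s : (forall i, i \in js -> pact s (v i) = 0) -> pact s (v j) = 0 ->
    pact s t = 0.
  move=> sjs sj; apply: contrapT => st; apply: no; exists s; split=> // i.
  by rewrite inE => /predU1P[->|/sjs].
have ext k0 k : k0 * x = x * k0 -> cent k -> t - v j * k0 = \sum_(i <- js) v i * k i ->
    cspan (j :: js) v t.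
  move=> ck0 ck tE; exists (fun i => if i == j then k0 else k i).
    by move=> i; case: eqP.
  rewrite big_cons eqxx -(subrK (v j * k0) t) tE addrC; congr (_ + _).
  by apply: eq_big_seq => i ijs; case: eqP => // ij; rewrite -ij ijs in jjs.
have [[k ck vjE]|/IHjs[//|s0 [s0js s0j]]] := pselect (cspan js v (v j)).
  apply: nt; have [[k' ck' tE]|/IHjs[//|s [sjs st]]] := pselect (cspan js v t).
    apply: (ext 0 k') => //; first by rewrite mul0r mulr0.
    by rewrite mulr0 subr0.
  exfalso; apply: st; apply: kill => //; rewrite vjE pact_sumr big1_seq // => i /= ijs.
  by rewrite pactMr // sjs // mul0r.
have [a [as0 _]] := divD s0j; pose s1 := a%:P * s0.
have s1js i : i \in js -> pact s1 (v i) = 0 by move=> /s0js si; rewrite pactM si pact0.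
have s1j : pact s1 (v j) = 1 by rewrite pactM pactC.
pose k0 := pact s1 t.
have tE s : (forall i, i \in js -> pact s (v i) = 0) -> pact s t = pact s (v j) * k0.
  move=> sjs; apply/eqP; rewrite -subr_eq0 -pactC -pactM -pactBl; apply/eqP.
  apply: kill => [i ijs|]; rewrite pactBl pactM pactC.
    by rewrite sjs // s1js // mulr0 subrr.
  by rewrite s1j mulr1 subrr.
have ck0 : k0 * x = x * k0.
  have -> : k0 * x = pact ('X * s1) t by rewrite pactXl.
  rewrite tE => [|i /s1js si]; last by rewrite pactXl si mul0r.
  by rewrite pactXl s1j mul1r.
have [[k ck tk]|/IHjs[//|s [sjs []]]] := pselect (cspan js v (t - v j * k0)).
  by apply: nt; exact: ext tk.
by rewrite pactBr tE // pactMr // subrr.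
Qed.

Lemma cfree_dual (js : seq nat) (v : nat -> D) (i : nat) (t : D) :
    uniq js -> cfree js v -> i \in js ->
  exists s, forall j, j \in js -> pact s (v j) = if j == i then t else 0.
Proof.
move=> ujs fv ijs; have [|s [sjs si]] := @density (rem i js) v (v i) (rem_uniq _ ujs).
  move=> [k ck vE]; pose k' j := if j == i then -1 else k j.
  have ck' : cent k' by move=> j; rewrite /k'; case: eqP; rewrite ?mulN1r ?mulrN1.
  have rel : \sum_(j <- js) v j * k' j = 0.
    rewrite (big_rem i) //= /k' eqxx mulrN1 {1}vE addrC; apply/eqP; rewrite subr_eq0.
    apply/eqP; apply: eq_big_seq => j; rewrite mem_rem_uniq // inE => /andP[ji _].
    by rewrite (negPf ji).
  by have /eqP := fv _ ck' rel i ijs; rewrite /k' eqxx oppr_eq0 oner_eq0.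
have [a [asi _]] := divD si; exists ((t * a)%:P * s) => j jjs; rewrite pactM pactC.
case: eqP => [->|/eqP ji]; first by rewrite -mulrA asi mulr1.
by rewrite sjs ?mulr0 // mem_rem_uniq // inE ji.
Qed.

Variables (p : nat) (d : nat) (W : word_poly).
Hypotheses (p_prime : prime p) (p0 : p%:R = 0 :> D).
Hypothesis Wperm : forall aw, aw \in W -> perm_eq aw.2 (iota 0 d).
Hypothesis Wcoef : ~~ (p %| word_coef W (iota 0 d))%Z.
Hypothesis Wsum : forall y : nat -> D, word_sum W y = 0.

(** Choose [y i] in [{poly D}] sending [v i.+1] to [v i] and killing the other vectors. Among the
    words of [W] only [0, ..., d-1] does not kill [v d], which it sends to [v 0]; the identity then
    forces [v 0 = 0]. *)
Lemma cfree_bounded (v : nat -> D) : ~ cfree (iota 0 d.+1) v.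
Proof.
move=> fv; have uj := iota_uniq 0 d.+1.
have sE i : exists s, (i < d)%N -> forall j, (j <= d)%N ->
    pact s (v j) = if j == i.+1 then v i else 0.
  have [lt_id|_] := ltnP i d; last by exists 0.
  have [|s sP] := @cfree_dual _ v i.+1 (v i) uj fv.
    by rewrite mem_iota ltnS.
  by exists s => _ j le_jd; apply: sP; rewrite mem_iota.
have [y yE] := choice sE.
have up k : (k <= d)%N -> pact (word_prod y (iota 0 k)) (v k) = v 0%N.
  elim: k => [|k IHk] lt_kd; first by rewrite /word_prod big_nil -polyC1 pactC mul1r.
  rewrite -addn1 iotaD /word_prod big_cat big_seq1 pactM addn1 yE // eqxx.
  by apply: IHk; exact: ltnW.
have down w k : (k <= d)%N -> all (fun i => i < d)%N w ->
    pact (word_prod y w) (v k) <> 0 ->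
    (size w <= k)%N /\ w = iota (k - size w) (size w).
  elim/last_ind: w k => [|w i IHw] k le_kd //.
  rewrite all_rcons => /andP[lt_id wd]; rewrite /word_prod -cats1 big_cat big_seq1 pactM.
  rewrite yE //; case: (k =P i.+1) => [->|_]; last by rewrite pact0.
  move=> /(IHw i (ltnW lt_id) wd)[le_wi wE]; rewrite size_cat addn1 subSS; split=> //.
  by rewrite -addn1 iotaD -wE subnK.
have y0 := word_sum_poly (iota_uniq 0 d) Wperm Wsum y.
have : pact (word_sum W y) (v d) = (word_coef W (iota 0 d))%:~R * v 0%N.
  rewrite /word_sum pact_suml /word_coef rmorph_sum mulr_suml [RHS]big_mkcond /=.
  apply: eq_big_seq => aw awW.
  have -> : pact (word_prod y aw.2 *~ aw.1) (v d) =
      aw.1%:~R * pact (word_prod y aw.2) (v d).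
    by rewrite -mulrzl -(rmorph_int polyC) pactM pactC.
  case: eqP => [->|neq]; first by rewrite up.
  have [->|nz] := pselect (pact (word_prod y aw.2) (v d) = 0).
    by rewrite mulr0.
  have pw := Wperm awW; have szw : size aw.2 = d by rewrite (perm_size pw) size_iota.
  case: (down aw.2 d (leqnn d) _ nz) => [|_ wE].
    by apply/allP => i; rewrite (perm_mem pw) mem_iota.
  by case: neq; rewrite wE szw subnn.
rewrite y0 -polyC0 pactC mul0r => /esym /division_domain[W0|v0].
  by move/negP: Wcoef; apply; exact: (intr_eq0_dvd p_prime p0).
pose k i : D := if i == 0%N then 1 else 0.
have ck : cent k by move=> i; rewrite /k; case: eqP; rewrite ?mul1r ?mulr1 ?mul0r ?mulr0.
have rel : \sum_(j <- iota 0 d.+1) v j * k j = 0.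
  rewrite big_cons v0 mul0r add0r big1_seq // => j /=; rewrite mem_iota => /andP[j_gt0 _].
  by rewrite /k gtn_eqF // mulr0.
by have /eqP := fv k ck rel 0%N (mem_head _ _); rewrite /k oner_eq0.
Qed.

Lemma cfree_spanning : exists n v, cfree (iota 0 n) v /\ forall t, cspan (iota 0 n) v t.
Proof.
apply: contrapT => no.
suff [v] : exists v, cfree (iota 0 d.+1) v by exact: cfree_bounded.
elim: d.+1 => [|n [v fv]]; first by exists (fun _ => 0).
have [t nt] : exists t, ~ cspan (iota 0 n) v t.
  by apply/existsNP => span; apply: no; exists n, v.
exists (fun i => if i == n then t else v i) => k ck.
rewrite -addn1 iotaD add0n big_cat big_seq1 /= eqxx => rel.
have rel' : \sum_(j <- iota 0 n) v j * k j = - (t * k n).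
  apply/eqP; rewrite -addr_eq0 -[X in _ == X]rel; apply/eqP; congr (_ + _).
  apply: eq_big_seq => j; rewrite mem_iota => /andP[_ lt_jn].
  by rewrite ltn_eqF.
have kn0 : k n = 0.
  apply: contrapT => kn; apply: nt; have [a [akn kna]] := divD kn.
  exists (fun j => - (k j * a)) => [j|].
    have ca : a * x = x * a.
      by rewrite -[a * x]mulr1 -kna -mulrA (mulrA x) -ck -(mulrA (k n)) mulrA akn mul1r.
    by rewrite mulNr mulrN -mulrA ca !mulrA ck.
  rewrite -[t]mulr1 -kna mulrA -[t * k n]opprK -rel' mulNr mulr_suml -sumrN.
  by apply: eq_bigr => j _; rewrite mulrN mulrA.
move=> j; rewrite mem_cat inE => /orP[|/eqP ->//].
by apply: fv => //; rewrite rel' kn0 mulr0 oppr0.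
Qed.

(** [D] has finite dimension over the centralizer of [x], so for [x <> 0] some [s] acts as right
    multiplication by the inverse of [x]; then ['X * s - 1] acts as 0, and its constant coefficient
    is -1. *)
Lemma pact_annihilator : exists2 g, g != 0 & forall t, pact g t = 0.
Proof.
have [x0|x0] := pselect (x = 0).
  exists 'X => [|t]; first by rewrite polyX_eq0.
  by rewrite -['X]mulr1 pactXl x0 mulr0.
have [y [yx xy]] := divD x0.
have [n [v [fv spanv]]] := cfree_spanning.
have [s sE] : exists s, forall j, j \in iota 0 n -> pact s (v j) = v j * y.
  have sE i : exists s, i \in iota 0 n -> forall j, j \in iota 0 n ->
      pact s (v j) = if j == i then v i * y else 0.
    have [iI|_] := boolP (i \in iota 0 n); last by exists 0.
    by have [s sP] := cfree_dual (v i * y) (iota_uniq 0 n) fv iI; exists s.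
  have [s sP] := choice sE; exists (\sum_(i <- iota 0 n) s i) => j jI.
  rewrite pact_suml (bigD1_seq j) ?iota_uniq //= sP // eqxx big1_seq ?addr0 // => i /andP[ij iI].
  by rewrite sP // eq_sym (negPf ij).
exists ('X * s - 1) => [|t].
  apply/eqP => /(congr1 (fun q : {poly D} => q`_0)).
  by rewrite coefB coefXM coef1 coef0 sub0r => /eqP; rewrite oppr_eq0 oner_eq0.
have [k ck ->] := spanv t.
rewrite pactBl pactXl -polyC1 pactC mul1r pact_sumr mulr_suml -sumrB.
rewrite big1_seq // => j /= jI; rewrite pactMr // sE // -!mulrA ck (mulrA y) yx mul1r.
by rewrite subrr.
Qed.

(** Take [g] monic of least degree acting as 0. Each [r g - g r] also acts as 0 and has smaller
    size, so it is 0 and the coefficients are central; acting on 1 gives [g.[x] = 0]. *)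
Lemma algebraic_over_center :
  exists g : {poly D}, [/\ g \is monic, forall i, central g`_i & g.[x] = 0].
Proof.
pose P n := `[< exists2 g : {poly D}, size g = n.+1 & forall t, pact g t = 0 >].
have exP : exists n, P n.
  have [g g0 gt] := pact_annihilator; exists (size g).-1; apply/asboolP; exists g => //.
  by rewrite prednK // lt0n size_poly_eq0.
case: (ex_minnP exP) => n /asboolP[h szh ht] min_n.
have hn : h`_n <> 0.
  move=> hn; have /eqP : lead_coef h = 0 by rewrite /lead_coef szh.
  by rewrite lead_coef_eq0 -size_poly_eq0 szh.
have [a [ah ha]] := divD hn; pose g := a%:P * h.
have gt t : pact g t = 0 by rewrite pactM ht pact0.
have szg : (size g <= n.+1)%N by rewrite -szh /g mul_polyC size_scale_leq.
have gn : g`_n = 1 by rewrite /g coefCM.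
have mon_g : g \is monic.
  have sz : size g = n.+1.
    apply/eqP; rewrite eqn_leq szg ltnNge; apply/negP => /leq_sizeP/(_ n (leqnn n)).
    by rewrite gn => /eqP; rewrite oner_eq0.
  by rewrite monicE /lead_coef sz gn.
exists g; split=> //; last by rewrite -(gt 1) /pact polyC1 mulr1.
have com r : r%:P * g - g * r%:P = 0.
  apply: contrapT => /eqP q0; set q := _ - _ in q0.
  have szq : (size q <= n)%N.
    apply/leq_sizeP => j; rewrite leq_eqVlt coefB coefCM coefMC => /predU1P[<-|lt_nj].
      by rewrite gn mulr1 mul1r subrr.
    by rewrite nth_default ?mulr0 ?mul0r ?subrr // (leq_trans szg).
  have /min_n : P (size q).-1.
    apply/asboolP; exists q; first by rewrite prednK // lt0n size_poly_eq0.
    by move=> t; rewrite /q pactBl (pactM r%:P g) (pactM g r%:P) !gt pact0 subrr.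
  by rewrite leqNgt prednK ?lt0n ?size_poly_eq0 // szq.
move=> i r; have := congr1 (fun q : {poly D} => q`_i) (com r).
by rewrite coefB coefCM coefMC coef0 => /eqP; rewrite subr_eq0 => /eqP.
Qed.

Hypothesis finZ : finite_pred (@central D).

(** Reduction by the monic [g] keeps all powers of [x] in the finite set [B] of central combinations
    of [1, ..., x^(n-1)]; two powers coincide, and [x] cancels. *)
Lemma finite_order : x <> 0 -> exists2 n, (0 < n)%N & x ^+ n = 1.
Proof.
move=> x0; have [g [mon_g gZ gx]] := algebraic_over_center.
pose n := (size g).-1.
have szg : size g = n.+1 by rewrite /n prednK // lt0n size_poly_eq0 monic_neq0.
have gn : g`_n = 1 by have /monicP := mon_g.
pose B t := exists2 q : {poly D}, (size q <= n)%N /\ (forall i, central q`_i) & t = q.[x].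
have ZB a b : @central D a -> central b -> central (a - b).
  by move=> ca cb r; rewrite mulrBl mulrBr ca cb.
have ZM a b : @central D a -> central b -> central (a * b).
  by move=> ca cb r; rewrite -mulrA cb mulrA ca mulrA.
have Z0 : @central D 0 by move=> r; rewrite mul0r mulr0.
have Z1 : @central D 1 by move=> r; rewrite mul1r mulr1.
have powB k : B (x ^+ k).
  elim: k => [|k [q [szq qZ] qE]].
    exists 1; last by rewrite hornerC.
    split; last by move=> i; rewrite coef1; case: (i == 0%N).
    rewrite size_poly1 lt0n; apply/eqP => n0.
    move: gx; rewrite (size1_polyC (p := g)) ?szg ?n0 // hornerC -n0 gn => /eqP.
    by rewrite oner_eq0.
  have qX_Z i : central (q * 'X)`_i by rewrite coefMX; case: (i == 0%N).
  exists (q * 'X - (q * 'X)`_n *: g); last first.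
    by rewrite hornerD hornerN hornerMX hornerZ gx mulr0 subr0 -qE exprSr.
  split=> [|i]; last by rewrite coefB coefZ; apply: ZB => //; exact: ZM.
  apply/leq_sizeP => j; rewrite leq_eqVlt coefB coefZ => /predU1P[<-|lt_nj].
    by rewrite gn mulr1 subrr.
  rewrite [g`_j]nth_default ?szg // mulr0 subr0 nth_default //.
  by rewrite (leq_trans (size_polyMleq _ _)) // size_polyX addn2 (leq_trans _ lt_nj).
have finB : finite_pred B.
  apply: finite_pred_sub (@finite_pred_sum _ n (fun i t =>
    exists a b : D, [/\ central a, b = x ^+ i & t = a * b]) _) _.
    move=> i _; apply: finite_pred_map2 => //.
    by exists [:: x ^+ i] => _ ->; rewrite inE.
  move=> _ [q [szq qZ] ->]; exists (fun i => q`_i * x ^+ i).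
    by move=> i _; exists q`_i, (x ^+ i).
  by rewrite (horner_coef_wide _ szq).
have [i [j [lt_ij xij]]] := finite_pred_pigeonhole finB powB.
exists (j - i)%N; first by rewrite subn_gt0.
have : x ^+ i * (x ^+ (j - i) - 1) = 0.
  by rewrite mulrBr mulr1 -exprD subnKC ?xij ?subrr // ltnW.
move=> /division_domain[xi0|/eqP]; last by rewrite subr_eq0 => /eqP.
exfalso; elim: i xi0 {lt_ij xij} => [|i IHi]; first by rewrite expr0 => /eqP; rewrite oner_eq0.
by rewrite exprS => /division_domain[].
Qed.

End Kaplansky.

(** * Torsion division rings *)

Section CyclicSpan.
Variables (D : nzRingType) (T : D -> Prop) (y : D) (m : nat).
Hypotheses (T0 : T 0) (TB : forall a b, T a -> T b -> T (a - b)).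
Hypothesis twist : forall t, T t -> exists2 t', T t' & y * t = t' * y.
Hypotheses (m_gt0 : (0 < m)%N) (ym : y ^+ m = 1).

Definition cyclic_span (z : D) : Prop :=
  exists2 k : nat -> D, (forall b, T (k b)) & z = \sum_(b < m) k b * y ^+ b.

Lemma cyclic_spanB a b : cyclic_span a -> cyclic_span b -> cyclic_span (a - b).
Proof.
move=> [k kT ->] [l lT ->]; exists (fun i => k i - l i); first by move=> i; exact: TB.
by rewrite -sumrB; apply: eq_bigr => i _; rewrite mulrBl.
Qed.

Lemma cyclic_span_sub t : T t -> cyclic_span t.
Proof.
move=> Tt; exists (fun b => if b == 0%N then t else 0); first by move=> b; case: eqP.
case: m m_gt0 => // m' _; rewrite big_ord_recl expr0 mulr1 big1 ?addr0 // => i _.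
by rewrite mul0r.
Qed.

Lemma cyclic_span_mull r z : (forall t, T t -> T (r * t)) ->
  cyclic_span z -> cyclic_span (r * z).
Proof.
move=> rT [k kT ->]; exists (fun b => r * k b); first by move=> b; exact: rT.
by rewrite mulr_sumr; apply: eq_bigr => b _; rewrite mulrA.
Qed.

(** [twist] moves [y] past the coefficients, and [y ^+ m = 1] returns the last term to degree 0. *)
Lemma cyclic_span_gen z : cyclic_span z -> cyclic_span (y * z).
Proof.
move=> [k kT ->].
have [k' k'P] : {k' : nat -> D & forall b, T (k' b) /\ y * k b = k' b * y}.
  by apply: (@choice _ _ (fun b t => T t /\ y * k b = t * y)) => b; have [t] := twist (kT b); exists t.
have [m' mE] : exists m', m = m'.+1 by exists m.-1; rewrite prednK.
exists (fun b => if b is b'.+1 then k' b' else k' m').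
  by move=> [|b]; [case: (k'P m')|case: (k'P b)].
rewrite mulr_sumr mE big_ord_recr big_ord_recl /= addrC; congr (_ + _).
  by rewrite mulrA (k'P m').2 -mulrA -exprS -mE ym expr0.
by apply: eq_bigr => b _; rewrite mulrA (k'P b).2 -mulrA -exprS.
Qed.

Lemma cyclic_span_finite : finite_pred T -> finite_pred cyclic_span.
Proof.
move=> finT; apply: finite_pred_sub (@finite_pred_sum _ m (fun i v =>
  exists a b : D, [/\ T a, b = y ^+ i & v = a * b]) _) _.
  move=> i _; apply: finite_pred_map2 => //.
  by exists [:: y ^+ i] => _ ->; rewrite inE.
by move=> _ [k kT ->]; exists (fun i => k i * y ^+ i) => // i _; exists (k i), (y ^+ i).
Qed.

End CyclicSpan.

(** [y i] is the discrete Fourier transform of the conjugates [x^j w x^(-j)], the exponent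
    [n.-1 * j] standing for [-j]. The [y i] sum to [n w] and [y 0] commutes with [x]; if all the
    others vanished, [n w] would commute with [x]. *)
Lemma eigenvector_exists (D : nzRingType) (x w : D) (n : nat) :
    is_domain D -> x ^+ n = 1 -> (0 < n)%N ->
    (forall j, (0 < j < n)%N -> x ^+ j <> 1) -> n%:R <> 0 :> D -> x * w <> w * x ->
  exists i y, [/\ (0 < i < n)%N, y <> 0 & y * x = x ^+ i.+1 * y].
Proof.
move=> dom xn n_gt0 xj n0 xw.
pose y i := \sum_(j < n) x ^+ (i * j) * (x ^+ j * w * x ^+ (n.-1 * j)).
have yx i : y i * x = x ^+ i.+1 * y i.
  pose G j := x ^+ (i * j) * (x ^+ j * w * x ^+ (n.-1 * j)) * x.
  have -> : y i * x = \sum_(j < n) G j by rewrite mulr_suml.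
  have -> : x ^+ i.+1 * y i = \sum_(j < n) G j.+1.
    rewrite mulr_sumr; apply: eq_bigr => j _; rewrite /G.
    have -> : x ^+ i.+1 * (x ^+ (i * j) * (x ^+ j * w * x ^+ (n.-1 * j))) =
        x ^+ (i.+1 + (i * j + j)) * w * x ^+ (n.-1 * j).
      by rewrite !exprD !mulrA.
    have -> : x ^+ (i * j.+1) * (x ^+ j.+1 * w * x ^+ (n.-1 * j.+1)) * x =
        x ^+ (i * j.+1 + j.+1) * w * (x ^+ (n.-1 * j.+1).+1).
      by rewrite exprD (exprSr x (n.-1 * j.+1)) !mulrA.
    congr (_ * _ * _); first by congr (_ ^+ _); rewrite mulnS; lia.
    have -> : (n.-1 * j.+1).+1 = (n + n.-1 * j)%N by rewrite mulnS -addSn prednK.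
    by rewrite exprD xn mul1r.
  have Gn : G n = G 0%N.
    rewrite /G !muln0 !expr0 !mul1r mulr1 (mulnC i) (mulnC n.-1) !exprM xn !expr1n.
    by rewrite !mul1r mulr1.
  have E1 : \sum_(j < n.+1) G j = G 0%N + \sum_(j < n) G j.+1 by rewrite big_ord_recl.
  have E2 : \sum_(j < n.+1) G j = \sum_(j < n) G j + G n by rewrite big_ord_recr.
  by apply: (addIr (G n)); rewrite -E2 E1 Gn addrC.
have sum_y : \sum_(i < n) y i = n%:R * w.
  rewrite exchange_big /=; case: n n_gt0 xn xj n0 @y yx => // n _ xn xj _ _ _.
  rewrite big_ord_recl addrC big1 ?add0r => [|j _].
    rewrite (eq_bigr (fun=> w)) => [|i _].
      by rewrite sumr_const card_ord mulr_natl.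
    by rewrite /= !muln0 !expr0 !mul1r mulr1.
  set t : D := _ * w * _; rewrite -mulr_suml.
  suff -> : \sum_(i < n.+1) x ^+ (i * lift ord0 j) = 0 by rewrite mul0r.
  have : (x ^+ j.+1 - 1) * \sum_(i < n.+1) x ^+ (i * lift ord0 j) = 0.
    rewrite (eq_bigr (fun i : 'I_n.+1 => (x ^+ j.+1) ^+ i)) => [|i _].
      by rewrite -subrX1 -exprM mulnC exprM xn expr1n subrr.
    by rewrite -exprM mulnC.
  by move=> /dom[/eqP|//]; rewrite subr_eq0 => /eqP xj1; case: (xj j.+1); rewrite //= ltnS.
apply: contrapT => no.
have y0 i : (0 < i < n)%N -> y i = 0.
  by move=> lt_in; apply: contrapT => yi; apply: no; exists i, (y i).
have nw : n%:R * w = y 0%N.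
  rewrite -sum_y; case: n n_gt0 {xn xj n0 sum_y no yx} @y y0 => // n _ y y0.
  by rewrite big_ord_recl big1 ?addr0 // => i _; rewrite y0 //= ltnS.
have : n%:R * (w * x - x * w) = 0.
  rewrite mulrBr mulrA nw yx expr1 (mulrA n%:R) -[n%:R * x]commr_nat -mulrA nw.
  by rewrite subrr.
by move=> /dom[//|/eqP]; rewrite subr_eq0 => /eqP /esym.
Qed.

Section NoFiniteNoncommutative.
Variable S : identity_set.
Hypothesis finite_commutative : forall R : nzRingType,
  satisfies S R -> finite_pred (fun _ : R => True) -> commutative (@GRing.mul R).

(** A noncentral [x] of order [n] has an eigenvector [y] with [y x = x^(i+1) y]. The span [F] of the
    products [x^a y^b] over the prime field is finite and stable under left multiplication by [x]
    and [y], so it contains the subring they generate, which is therefore commutative; but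
    [x^(i+1) <> x]. *)
Lemma torsion_division_commutative (D : nzRingType) (p : nat) :
    satisfies S D -> is_division D -> prime p -> p%:R = 0 :> D ->
    (forall x : D, x <> 0 -> exists2 n, (0 < n)%N & x ^+ n = 1) ->
  commutative (@GRing.mul D).
Proof.
move=> satD divD p_prime p0 tors x w; apply: contrapT => xw.
have dom := division_domain divD.
have x0 : x <> 0 by move=> x0; apply: xw; rewrite x0 mul0r mulr0.
pose P n := (0 < n)%N && (x ^+ n == 1).
have exP : exists n, P n.
  by have [n n_gt0 xn] := tors x x0; exists n; rewrite /P n_gt0 xn eqxx.
case: (ex_minnP exP) => n /andP[n_gt0 /eqP xn] min_n.
have xj j : (0 < j < n)%N -> x ^+ j <> 1.
  move=> /andP[j_gt0 lt_jn] xj; have := min_n j.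
  by rewrite /P j_gt0 xj eqxx leqNgt lt_jn => /(_ isT).
(* If [n = m p], the Frobenius map sends [x^m - 1] to [x^n - 1 = 0], against the minimality of
   [n]. *)
have n0 : n%:R <> 0 :> D.
  move=> n0; have : (p %| n%:Z)%Z by exact: (intr_eq0_dvd p_prime p0).
  move=> /dvdnP[m nE]; have p_char : p \in [pchar D] by rewrite inE p_prime p0 eqxx.
  have m_gt0 : (0 < m)%N by move: n_gt0; rewrite [n]nE muln_gt0 => /andP[].
  have lt_mn : (m < n)%N by rewrite [n]nE ltn_Pmulr // prime_gt1.
  have frob : pFrobenius_aut p_char (x ^+ m - 1) = 0.
    rewrite pFrobenius_autB_comm; last exact: commr1.
    by rewrite pFrobenius_aut1 pFrobenius_autE -exprM -nE xn subrr.
  apply: (xj m); first by rewrite m_gt0.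
  apply/eqP; rewrite -subr_eq0; apply/eqP; move: frob; rewrite pFrobenius_autE.
  elim: (p) => [/eqP|k IHk]; first by rewrite expr0 oner_eq0.
  by rewrite exprS => /dom[|/IHk].
have [i [y [lt_in y0 yx]]] := eigenvector_exists dom xn n_gt0 xj n0 xw.
have [m m_gt0 ym] := tors y y0.
pose Z (t : D) := exists z : int, t = z%:~R.
have Z0 : Z 0 by exists 0.
have ZB a b : Z a -> Z b -> Z (a - b) by move=> [u ->] [v ->]; exists (u - v); rewrite rmorphB.
have finZ : finite_pred Z := finite_intr (prime_gt0 p_prime) p0.
have Ztwist u t : Z t -> exists2 t', Z t' & u * t = t' * u.
  by move=> [z ->]; exists z%:~R; [exists z|rewrite commr_int].
pose K := cyclic_span Z x n.
have KB := cyclic_spanB ZB : forall a b, K a -> K b -> K (a - b).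
have K1 : K 1 by apply: cyclic_span_sub => //; exists 1.
have K0 : K 0 by rewrite -(subrr 1); exact: KB.
have KX e : K (x ^+ e).
  by elim: e => [|e IHe]; rewrite ?expr0 ?exprS //; exact: (cyclic_span_gen (Ztwist x)).
have Kint (z : int) t : K t -> K (z%:~R * t).
  by apply: cyclic_span_mull => _ [z' ->]; exists (z * z'); rewrite rmorphM.
have KD a b : K a -> K b -> K (a + b).
  by move=> Ka Kb; rewrite -[b]opprK -[- b]add0r; apply: (KB) => //; exact: KB.
have Ktwist t : K t -> exists2 t', K t' & y * t = t' * y.
  move=> [k kZ ->]; exists (\sum_(b < n) k b * (x ^+ i.+1) ^+ b).
    apply: big_ind => // b _; have [z ->] := kZ b.
    by apply: Kint; rewrite -exprM; exact: KX.
  rewrite mulr_sumr mulr_suml; apply: eq_bigr => b _; have [z ->] := kZ b.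
  rewrite mulrA commr_int -!mulrA; congr (_ * _).
  elim: (nat_of_ord b) => [|a IHa]; first by rewrite !expr0 mulr1 mul1r.
  by rewrite exprSr mulrA IHa -mulrA yx mulrA -exprSr.
pose F := cyclic_span K y m.
have FB := cyclic_spanB KB : forall a b, F a -> F b -> F (a - b).
have F1 : F 1 by exact: cyclic_span_sub.
have finF : finite_pred F by apply: cyclic_span_finite; exact: cyclic_span_finite.
have GF r : gen_subring x y r -> F r.
  move=> Gr; rewrite -[r]mulr1; move: (1 : D) F1.
  apply: (Gr (fun r => forall t, F t -> F (r * t))).
  - split=> [t|a b Fa Fb t Ft|a b Fa Fb t Ft]; first by rewrite mul1r.
      by rewrite mulrBl; apply: FB; auto.
    by rewrite -mulrA; auto.
  - by move=> t; apply: cyclic_span_mull => u; exact: (cyclic_span_gen (Ztwist x)).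
  - by move=> t; exact: (cyclic_span_gen Ktwist).
have sG := subring_gen x y.
have [||Q [pi qpi]] := @subquotient_exists D (gen_subring x y) (fun a => a = 0) sG.
- split=> [a ->||a b -> ->|r a _ ->|r a _ ->] //; rewrite ?subrr ?mulr0 ?mul0r //.
  exact: subring0.
- by move/eqP; rewrite oner_eq0.
have finQ : finite_pred (fun _ : Q => True).
  apply: (finite_pred_image (f := fun t q => gen_subring x y t /\ pi t = q) finF).
    by move=> q _; have [a Ga <-] := sq_onto qpi q; exists a => //; exact: GF.
  by move=> t u v _ _ [_ <-] [_ <-].
have Gx := @gen_subring_l D x y; have Gy := @gen_subring_r D x y.
have comm := finite_commutative (satisfies_subquotient sG qpi satD) finQ.
have : x * y - y * x = 0.
  apply/(sq_eq0 qpi); first by apply: (subringB sG); exact: (subringM sG).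
  rewrite (sqB qpi) ?(sqM qpi) //; try exact: (subringM sG).
  by rewrite (comm (pi x)) subrr.
rewrite yx exprS -mulrA -mulrBr => /dom[//|].
rewrite -{1}[y]mul1r -mulrBl => /dom[/eqP|//].
by rewrite subr_eq0 eq_sym => /eqP; exact: xj.
Qed.

End NoFiniteNoncommutative.

(** * Matrix rings over prime fields and the conclusion *)

Lemma matrix_noncommutative (p : nat) : noncommutative ('M['F_p]_2).
Proof.
pose E (i j : 'I_2) : 'M['F_p]_2 := delta_mx i j.
move=> /(_ (E 0 1) (E 1 0)) /matrixP/(_ 0 0).
rewrite -!mulmxE !mul_delta_mx !mxE /= => /eqP.
by rewrite oner_eq0.
Qed.

Lemma matrix_satisfies (S : identity_set) (p : nat) : prime p ->
    (forall (s : nat) (P : ncpoly s), S s P -> forall m, (p %| P@_m)%Z) ->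
  satisfies S ('M['F_p]_2).
Proof.
move=> p_prime Sp s P SP r; rewrite /nceval mmapE big1 // => m _.
have /dvdzP[q ->] := Sp _ _ SP m.
have p0 : p%:R = 0 :> 'M['F_p]_2.
  by rewrite -scaler_nat; have /andP[_ /eqP ->] := pchar_Fp p_prime; rewrite scale0r.
by rewrite intrM -[p%:~R]/(p%:R) p0 mulr0 mul0r.
Qed.

Theorem theorem2p4 (S : identity_set) :
  (exists R : nzRingType, noncommutative R /\ satisfies S R) ->
  exists R : finNzRingType, noncommutative R /\ satisfies S R.
Proof.
move=> [R [ncR satR]]; apply: contrapT => noQ.
have finC (Q : nzRingType) : satisfies S Q -> finite_pred (fun _ : Q => True) ->
    commutative (@GRing.mul Q).
  move=> satQ finQ; apply: contrapT => ncQ; apply: noQ.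
  exact: finite_ring_noncommutative finQ ncQ satQ.
apply: ncR => x y; apply: contrapT => /subdirectly_irreducible_subquotient.
move=> [Q [I [pi [qpi c0 Hc]]]].
have satQ := satisfies_subquotient (subring_gen x y) qpi satR.
have gQ := generated_subquotient qpi.
have dom : is_domain Q := heart_domain finC satQ gQ c0 Hc.
have ncQ : ~ commutative (@GRing.mul Q) by move=> comm; apply: c0; rewrite comm subrr.
have finZ : finite_pred (@central Q).
  by apply: contrapT => infZ; apply: ncQ; exact: (infinite_center_commutative finC dom satQ infZ).
(* The images of the natural numbers are central, so two of them coincide in the finite center. *)
have [n [n_gt0 n0]] : exists n, (0 < n)%N /\ n%:R = 0 :> Q.
  have [|i [j [lt_ij ij]]] := finite_pred_pigeonhole (f := fun i => i%:R) finZ.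
    by move=> i r; apply: commr_sym; exact: commr_nat.
  by exists (j - i)%N; rewrite subn_gt0 lt_ij natrB ?(ltnW lt_ij) // ij subrr.
have [p p_prime p0] : exists2 p, prime p & p%:R = 0 :> Q.
  elim: {n}n.+1 {-2}n (ltnSn n) n_gt0 n0 => // k IHk n lt_nk n_gt0 n0.
  have n_gt1 : (1 < n)%N.
    by case: n n_gt0 n0 {lt_nk} => [|[|n]] // _ /eqP; rewrite oner_eq0.
  have pn := pdiv_prime n_gt1; have nE := divnK (pdiv_dvd n).
  move: n0; rewrite -nE natrM => /dom[n'0|]; last by exists (pdiv n).
  apply: (IHk (n %/ pdiv n)%N) => //; last by rewrite divn_gt0 ?prime_gt0 // dvdn_leq // pdiv_dvd.
  by rewrite (leq_trans (ltn_Pdiv (prime_gt1 pn) n_gt0)).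
(* If [p] divided all coefficients of all identities in [S], the 2 x 2 matrices over ['F_p] would be
   the finite ring excluded by [noQ]. *)
have [[s [P [SP [m pm]]]]|no] := pselect (exists s (P : ncpoly s), S s P /\
    exists m, ~~ (p %| P@_m)%Z); last first.
  apply: noQ; exists ('M['F_p]_2 : finNzRingType); split; first exact: matrix_noncommutative.
  apply: (matrix_satisfies p_prime) => s P SP m; apply: contrapT => /negP pm.
  by apply: no; exists s, P; split=> //; exists m.
have [d [W [Wperm Wcoef Wsum]]] := multilinearize pm.
have WQ y' : word_sum W y' = 0 :> Q by apply: Wsum => //; exact: satQ.
have divQ := heart_division dom c0 Hc p_prime p0 (iota_uniq 0 d) Wperm Wcoef WQ.
apply: ncQ; apply: (torsion_division_commutative finC satQ divQ p_prime p0) => z z0.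
exact (finite_order divQ p_prime p0 Wperm Wcoef WQ finZ z0).
Qed.
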